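(* Let $m,n$ be positive integers, let $A=\{(p,q)\in\mathbb{Z}^2: 0\le p<m,\ 0\le q<n\}$, and let $D=\{(a_h,b_h): h=1,\ldots,d\}$ be a finite set of $d \geq 1$ primitive directions. Let $f:A\to\mathbb{R}$ be an unknown function, and suppose that all the line sums of $f$ in the directions of $D$ are known. Then one can compute in linear time (that is, by an algorithm whose input is $m$, $n$, $D$ and these line sums, using $\mathcal{O}(dmn)$ basic operations) a function $g:A\to\mathbb{R}$ that satisfies the line sums, i.e. that has the same line sums as $f$ in all the directions of $D$. Moreover, the points which do not belong to any switching domain of $(A,D)$ get their original $f$-value: $g(p,q)=f(p,q)$ for every $(p,q)\in A$ which does not belong to any switching domain of $(A,D)$.
   Context: A primitive direction is a pair $(a,b)$ of coprime integers; the directions $(a,b)$ and $(-a,-b)$ are identified. In particular $(1,0)$ and $(0,1)$ are the horizontal and vertical directions. The elements of $D$ are distinct as directions under this identification, and $d$ is their number. For a direction $(a,b)$ and an integer $c$, let $L(a,b,c)$ be the lattice line $ay=bx+c$. For a function $f:A\to\mathbb{R}$, the line sum of $f$ along $L(a,b,c)$ is $$\ell(a,b,c,f)=\sum_{aq=bp+c,\ (p,q)\in A} f(p,q).$$ The line sums of $f$ in the directions of $D$ are the values $\ell(a,b,c,f)$ for all $(a,b)\in D$ and all $c\in\mathbb{Z}$ (only finitely many of these lines meet $A$). The line sums are exact (no noise). A function $F:A\to\mathbb{R}$ is called a switching function (or ghost) of $(A,D)$ if all the line sums of $F$ in all the directions of $D$ are zero. The support $\{(p,q)\in A: F(p,q)\neq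 0\}$ of a switching function $F$ is called a switching domain of $(A,D)$. Something can be computed in linear time if the number of basic operations needed to compute it is $\mathcal{O}(dmn)$. A basic operation is an addition, subtraction, multiplication, division, decision about which of two quantities is larger, or an assignment (real-number arithmetic counted at unit cost). *)

(* Defs.v *)
From mathcomp Require Import all_boot all_order all_algebra.
From mathcomp Require Import reals.

Set Implicit Arguments.
Unset Strict Implicit.
Unset Printing Implicit Defensive.

Import Order.TTheory GRing.Theory Num.Theory.

Local Open Scope ring_scope.

(** * Discrete tomography on the grid A = [0, m) x [0, n) *)

(* The point (p, q) of A is the pair of ordinals (p, q). *)
Definition grid (m n : nat) : finType := ('I_m * 'I_n)%type.

(* [coprimez 0 0] is false, so a primitive direction is nonzero. *)
Definition primitive (v : int * int) : bool := coprimez v.1 v.2.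

(* A set of primitive directions is given by an enumeration without repetition;
   v and - v are the same direction. *)
Definition direction_set (D : seq (int * int)) : bool :=
  all primitive D && pairwise (fun v w => (v != w) && (v != - w)) D.

(* l(a, b, c, f), with v = (a, b): the sum over the line a y = b x + c. *)
Definition line_sum (R : realType) (m n : nat) (f : grid m n -> R)
    (v : int * int) (c : int) : R :=
  \sum_(u : grid m n | v.1 * (u.2 : nat)%:Z == v.2 * (u.1 : nat)%:Z + c) f u.

Definition switching_function (R : realType) (m n : nat)
    (D : seq (int * int)) (F : grid m n -> R) : Prop :=
  forall (v : int * int) (c : int), v \in D -> line_sum F v c = 0.

Definition switching_domain (R : realType) (m n : nat)
    (D : seq (int * int)) (S : {set grid m n}) : Prop :=
  exists2 F : grid m n -> R,
    switching_function D F & S = [set u | F u != 0].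

(** * A real random access machine

   Programs are finite syntactic objects that do not depend on the instance.
   The memory consists of integer cells (used for indices and addresses) and
   real cells.  Both are organised in arrays: a cell is given by the name of
   its array, which is fixed in the program text, and by two integer indices,
   which are computed.  A scalar variable is a cell with indices (0, 0).
   Integers are only added, subtracted, multiplied and compared; in particular
   neither an integer quotient nor the floor of a real number is available. *)

Inductive zexp : Type :=
| ZConst of int
| ZGet of nat & zexp & zexp
| ZAdd of zexp & zexp
| ZSub of zexp & zexp
| ZMul of zexp & zexp.

Inductive rexp : Type :=
| RofZ of zexp
| RGet of nat & zexp & zexp
| RAdd of rexp & rexp
| RSub of rexp & rexp
| RMul of rexp & rexp
| RDiv of rexp & rexp.

Inductive bexp : Type :=
| BZlt of zexp & zexp
| BRlt of rexp & rexp
| BNot of bexp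
| BAnd of bexp & bexp.

Inductive cmd : Type :=
| Skip
| ZSet of nat & zexp & zexp & zexp  (* array, two indices, new value *)
| RSet of nat & zexp & zexp & rexp
| Seq of cmd & cmd
| If of bexp & cmd & cmd
| While of bexp & cmd.

Record state (R : Type) : Type := State {
  zmem : nat -> int -> int -> int;
  rmem : nat -> int -> int -> R }.

Definition upd (T : Type) (M : nat -> int -> int -> T)
    (x : nat) (i j : int) (a : T) : nat -> int -> int -> T :=
  fun x' i' j' => if [&& x' == x, i' == i & j' == j] then a else M x' i' j'.

Fixpoint zeval (R : Type) (s : state R) (e : zexp) : int :=
  match e with
  | ZConst k => k
  | ZGet x i j => zmem s x (zeval s i) (zeval s j)
  | ZAdd e1 e2 => zeval s e1 + zeval s e2
  | ZSub e1 e2 => zeval s e1 - zeval s e2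
  | ZMul e1 e2 => zeval s e1 * zeval s e2
  end.

(* As usual in MathComp, x / 0 = 0; a program may test for 0 in any case. *)
Fixpoint reval (R : realType) (s : state R) (e : rexp) : R :=
  match e with
  | RofZ e1 => (zeval s e1)%:~R
  | RGet x i j => rmem s x (zeval s i) (zeval s j)
  | RAdd e1 e2 => reval s e1 + reval s e2
  | RSub e1 e2 => reval s e1 - reval s e2
  | RMul e1 e2 => reval s e1 * reval s e2
  | RDiv e1 e2 => reval s e1 / reval s e2
  end.

Fixpoint beval (R : realType) (s : state R) (b : bexp) : bool :=
  match b with
  | BZlt e1 e2 => zeval s e1 < zeval s e2
  | BRlt e1 e2 => reval s e1 < reval s e2
  | BNot b1 => ~~ beval s b1
  | BAnd b1 b2 => beval s b1 && beval s b2
  end.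

(* Every node of an expression is charged one basic operation, including
   constants, memory accesses and Boolean connectives; both arguments of a
   conjunction are charged. *)
Fixpoint zcost (e : zexp) : nat :=
  match e with
  | ZConst _ => 1
  | ZGet _ e1 e2 | ZAdd e1 e2 | ZSub e1 e2 | ZMul e1 e2 =>
      (zcost e1 + zcost e2).+1
  end.

Fixpoint rcost (e : rexp) : nat :=
  match e with
  | RofZ e1 => (zcost e1).+1
  | RGet _ i j => (zcost i + zcost j).+1
  | RAdd e1 e2 | RSub e1 e2 | RMul e1 e2 | RDiv e1 e2 =>
      (rcost e1 + rcost e2).+1
  end.

Fixpoint bcost (b : bexp) : nat :=
  match b with
  | BZlt e1 e2 => (zcost e1 + zcost e2).+1
  | BRlt e1 e2 => (rcost e1 + rcost e2).+1
  | BNot b1 => (bcost b1).+1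
  | BAnd b1 b2 => (bcost b1 + bcost b2).+1
  end.

(* [exec P s t s']: started in s, the program P halts in s' after t basic
   operations.  The rules are deterministic. *)
Inductive exec (R : realType) : cmd -> state R -> nat -> state R -> Prop :=
| ExecSkip s : exec Skip s 0 s
| ExecZSet x i j e s :
    exec (ZSet x i j e) s (zcost i + zcost j + zcost e).+1
      (State (upd (zmem s) x (zeval s i) (zeval s j) (zeval s e)) (rmem s))
| ExecRSet x i j e s :
    exec (RSet x i j e) s (zcost i + zcost j + rcost e).+1
      (State (zmem s) (upd (rmem s) x (zeval s i) (zeval s j) (reval s e)))
| ExecSeq c1 c2 s t1 s1 t2 s2 :
    exec c1 s t1 s1 -> exec c2 s1 t2 s2 -> exec (Seq c1 c2) s (t1 + t2) s2
| ExecIfTrue b c1 c2 s t s1 :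
    beval s b -> exec c1 s t s1 -> exec (If b c1 c2) s (bcost b + t) s1
| ExecIfFalse b c1 c2 s t s1 :
    ~~ beval s b -> exec c2 s t s1 -> exec (If b c1 c2) s (bcost b + t) s1
| ExecWhileTrue b c s t1 s1 t2 s2 :
    beval s b -> exec c s t1 s1 -> exec (While b c) s1 t2 s2 ->
    exec (While b c) s (bcost b + t1 + t2) s2
| ExecWhileFalse b c s :
    ~~ beval s b -> exec (While b c) s (bcost b) s.

(** * Input and output conventions

   Integer array 0 holds m, n, d at (0, 0), (1, 0), (2, 0); integer array 1
   holds a_h at (h, 0) and b_h at (h, 1) for 0 <= h < d; real array 0 holds at
   (h, c) the line sum of the h-th direction for the integer c.  All the other
   cells are 0.  The output is read in real array 1. *)

Definition input_state (R : realType) (m n : nat) (D : seq (int * int))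
    (ls : int * int -> int -> R) : state R :=
  {| zmem := fun x i j =>
       match x, i, j with
       | 0%N, Posz 0, Posz 0 => m%:Z
       | 0%N, Posz 1, Posz 0 => n%:Z
       | 0%N, Posz 2, Posz 0 => (size D)%:Z
       | 1%N, Posz h, Posz 0 => if (h < size D)%N then (D`_h).1 else 0
       | 1%N, Posz h, Posz 1 => if (h < size D)%N then (D`_h).2 else 0
       | _, _, _ => 0
       end;
     rmem := fun x i c =>
       match x, i with
       | 0%N, Posz h => if (h < size D)%N then ls D`_h c else 0
       | _, _ => 0
       end |}.

Definition output (R : realType) (m n : nat) (s : state R) : grid m n -> R :=
  fun u => rmem s 1 (u.1 : nat)%:Z (u.2 : nat)%:Z.

(* Main.v *)
Require Import Defs.
From mathcomp Require Import all_boot all_order all_algebra.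
From mathcomp Require Import reals.
From mathcomp Require Import zify ring.

Set Implicit Arguments.
Unset Strict Implicit.
Unset Printing Implicit Defensive.

Import Order.TTheory GRing.Theory Num.Theory.

Local Open Scope ring_scope.

(* Let [T_v] be the translation by [v].  A function on a box [B] with zero line
   sums in the direction [v] is of the form [T_v F - F] for a function [F] on
   [B :&: (B - v)].  Let [r] carry the line sums of [f] in the direction [v] on
   the first point of each line.  Then [f = r + T_v f' - f'], and the line sums
   of [f'] in another direction [w] are obtained from those of [f - r] by a
   recurrence, since [T_v] shifts the lines of direction [w] by the nonzero
   integer [w.1 * v.2 - w.2 * v.1].  One direction is used up in each round; the
   last quotient is replaced by [0] and the function [g] is computed backwards.
   Then [f - g] is a switching function, which also shows that [g] is correct
   outside of the switching domains.

   For the time bound, only the first [e] directions are used, where [e] is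
   minimal such that the sum of the [`|a_h|] is at least [m] or the sum of the
   [`|b_h|] is at least [n] (or [e = d]); if [e < d] then the last box is empty
   and [g = f].  The rounds run through these directions in the reverse order:
   the direction [e - 1], which may have a large number of lines, comes first,
   and the other ones have at most [2mn] lines altogether, all of whose sums can
   be updated in each round.  The number of points in the support of [r] is the
   number of points lost by the box, so that it is at most [mn] in total. *)

(** * Boxes, lines and sums over the grid *)

Definition box : Type := (int * int) * (int * int).

Definition in_box (B : box) (x y : int) : bool :=
  [&& B.1.1 <= x, x < B.1.2, B.2.1 <= y & y < B.2.2].

Definition grid_box (m n : nat) : box := ((0, m%:Z), (0, n%:Z)).

Definition supported (V : nmodType) (F : int -> int -> V) (B : box) :=
  forall x y, ~~ in_box B x y -> F x y = 0.

Definition sub_box (B B' : box) := forall x y, in_box B x y -> in_box B' x y.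

(** The bounds may cross when the result is empty, so that the two widths always drop by exactly
    [|v.1|] and [|v.2|]. *)
Definition shrink (v : int * int) (B : box) : box :=
  ((if v.1 < 0 then B.1.1 - v.1 else B.1.1,
    if v.1 < 0 then B.1.2 else B.1.2 - v.1),
   (if v.2 < 0 then B.2.1 - v.2 else B.2.1,
    if v.2 < 0 then B.2.2 else B.2.2 - v.2)).

Lemma in_shrink v B x y :
  in_box (shrink v B) x y = in_box B x y && in_box B (x + v.1) (y + v.2).
Proof.
case: B v => [[x0 x1] [y0 y1]] [a b]; rewrite /in_box /shrink /=.
by case: (ltrP a 0); case: (ltrP b 0) => ? ?; lia.
Qed.

(** The integer [c] of the line of direction [v] through the point; it is also the determinant of
    [v] and [(x, y)], hence linear in the point. *)
Definition crd (v : int * int) (x y : int) : int := v.1 * y - v.2 * x.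

Lemma crdB v x y x' y' : crd v (x - x') (y - y') = crd v x y - crd v x' y'.
Proof. by rewrite /crd; ring. Qed.

Lemma crd_self v : crd v v.1 v.2 = 0.
Proof. by rewrite /crd; ring. Qed.

(** A Bezout relation for the coprime coordinates of [v] yields the integer [t]. *)
Lemma same_line v x y x' y' : primitive v -> crd v x' y' = crd v x y ->
  exists t, x' = x + t * v.1 /\ y' = y + t * v.2.
Proof.
rewrite /primitive /coprimez /crd => /eqP prim eq_c.
have [u [w uw1]] := Bezoutz v.1 v.2; rewrite prim in uw1.
exists (u * (x' - x) + w * (y' - y)).
have e1 : v.1 * (y' - y) = v.2 * (x' - x) by lia.
split.
  have -> : (u * (x' - x) + w * (y' - y)) * v.1
          = (u * v.1) * (x' - x) + w * (v.1 * (y' - y)) by ring.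
  rewrite e1; have -> : w * (v.2 * (x' - x)) = (w * v.2) * (x' - x) by ring.
  by rewrite -mulrDl uw1; ring.
have -> : (u * (x' - x) + w * (y' - y)) * v.2
        = u * (v.2 * (x' - x)) + w * v.2 * (y' - y) by ring.
rewrite -e1; have -> : u * (v.1 * (y' - y)) = (u * v.1) * (y' - y) by ring.
by rewrite -mulrDl uw1; ring.
Qed.

(** If the determinant vanishes, [w] lies on the line through the origin in the direction [v], so
    [w = t v]; primitivity of [w] forces [t = 1] or [t = -1]. *)
Lemma crd_neq0 v w : primitive v -> primitive w -> v != w -> v != - w ->
  crd v w.1 w.2 != 0.
Proof.
move=> pv pw nvw nvw'; apply/eqP => c0.
have [|t []] := @same_line v 0 0 w.1 w.2 pv.
  by rewrite c0 /crd; ring.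
rewrite !add0r => e1 e2.
have := pw; rewrite /primitive /coprimez => /eqP gw.
have [u [k uk1]] := Bezoutz w.1 w.2; rewrite gw e1 e2 in uk1.
have [t1|t1] : t = 1 \/ t = -1.
  have : t * (u * v.1 + k * v.2) = 1 by rewrite -uk1; ring.
  by move=> /(congr1 absz); rewrite abszM => /eqP; rewrite muln_eq1; lia.
  move/eqP: nvw; apply; case: v w e1 e2 {nvw' pv pw c0 gw uk1} => ? ? [? ?] /= -> ->.
  by rewrite t1 !mul1r.
move/eqP: nvw'; apply; case: v w e1 e2 {nvw pv pw c0 gw uk1} => ? ? [? ?] /= -> ->.
by rewrite t1 !mulN1r; congr pair; rewrite opprK.
Qed.

(** Orders the points of each line of primitive direction [v]: a step by [v] adds the squared norm
    of [v]. *)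
Definition dot (v : int * int) (x y : int) : int := v.1 * x + v.2 * y.

Lemma normv_gt0 v : primitive v -> 0 < dot v v.1 v.2.
Proof.
rewrite /primitive /coprimez /dot => /eqP prim.
have [u [w]] := Bezoutz v.1 v.2; rewrite prim.
case: (v) => a b /= uw1; rewrite -!expr2 lt_neqAle addr_ge0 ?sqr_ge0 // andbT.
rewrite eq_sym paddr_eq0 ?sqr_ge0 // !sqrf_eq0; apply/negP => /andP[/eqP a0 /eqP b0].
by rewrite a0 b0 !mulr0 in uw1.
Qed.

Lemma dotD v x y t : dot v (x + t * v.1) (y + t * v.2)
  = dot v x y + t * dot v v.1 v.2.
Proof. by rewrite /dot; ring. Qed.

Lemma dotB v x y : dot v (x - v.1) (y - v.2) = dot v x y - dot v v.1 v.2.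
Proof. by rewrite /dot; ring. Qed.

Lemma in_box_between B v x y j k : in_box B (x - j * v.1) (y - j * v.2) ->
  in_box B (x + k * v.1) (y + k * v.2) -> 0 <= j -> 0 <= k -> in_box B x y.
Proof.
case: B v => [[x0 x1] [y0 y1]] [a b]; rewrite /in_box /=.
move=> /and4P[? ? ? ?] /and4P[? ? ? ?] j0 k0.
have sgn (w : int) : 0 <= j * w /\ 0 <= k * w \/ j * w <= 0 /\ k * w <= 0.
  case: (lerP 0 w) => w0; [left; split; exact: mulr_ge0|right].
  by split; apply: mulr_ge0_le0 => //; exact: ltW.
by apply/and4P; have := sgn a; have := sgn b; split; lia.
Qed.

(** * Sums over the grid and over lines, and their behaviour under translation *)

Section GridSum.
Variables (V : nmodType) (m n : nat).
Implicit Types F G : int -> int -> V.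
Local Notation A := (grid_box m n).

(** With values in any [nmodType], the same lemmas serve for line sums and for counting points in
    [nat]. *)
Definition gsum F : V := \sum_(u : grid m n) F (u.1 : nat)%:Z (u.2 : nat)%:Z.

Definition lsum F (v : int * int) (c : int) : V :=
  gsum (fun x y => if crd v x y == c then F x y else 0).

Lemma eq_gsum F G : (forall x y, in_box A x y -> F x y = G x y) ->
  gsum F = gsum G.
Proof.
move=> eqFG; apply: eq_bigr => [[p q] _]; apply: eqFG.
by rewrite /in_box /=; have := ltn_ord p; have := ltn_ord q; lia.
Qed.

Lemma gsum0 F : (forall x y, in_box A x y -> F x y = 0) -> gsum F = 0.
Proof. by move=> F0; rewrite (eq_gsum F0) /gsum big1. Qed.

Lemma gsumD F G : gsum (fun x y => F x y + G x y) = gsum F + gsum G.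
Proof. exact: big_split. Qed.

Lemma gsumE F :
  gsum F = \sum_(0 <= p < m) \sum_(0 <= q < n) F p%:Z q%:Z.
Proof.
rewrite /gsum big_mkord -(pair_bigA _ (fun p q => F (nat_of_ord p)%:Z (nat_of_ord q)%:Z)) /=.
by apply: eq_bigr => p _; rewrite big_mkord.
Qed.

Lemma gsum_pick a b F :
  gsum (fun x y => if (x == a) && (y == b) then F x y else 0)
  = if in_box A a b then F a b else 0.
Proof.
case: ifP => [|nA].
  case/and4P=> /= a0 am b0 bn; case: a a0 am => [p|p] // _ lp.
  case: b b0 bn => [q|q] // _ lq; rewrite !ltz_nat in lp lq.
  rewrite /gsum (bigD1 (Ordinal lp, Ordinal lq)) //= !eqxx /= big1 ?addr0 //.
  move=> [p' q'] /=; rewrite xpair_eqE -!val_eqE /= !eqz_nat.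
  by move/negbTE->.
apply: gsum0 => x y xyA; case: ifP => // /andP[/eqP xa /eqP yb].
by rewrite xa yb nA in xyA.
Qed.

(** Each value is written as a sum of functions concentrated at one point, and the two sums are
    exchanged. The support hypotheses ensure that no nonzero value crosses the border. *)
Lemma gsum_shift a b F : supported F A ->
  supported (fun x y => F (x - a) (y - b)) A ->
  gsum (fun x y => F (x - a) (y - b)) = gsum F.
Proof.
move=> sF sFT.
transitivity (gsum (fun x y => gsum (fun x' y' =>
   if (x' == x - a) && (y' == y - b) then F x' y' else 0))).
  apply: eq_gsum => x y _; rewrite gsum_pick.
  by case: ifP => // /negbT /sF.
rewrite /gsum exchange_big /=; apply: eq_bigr => [[p q] _] /=.
set F' := F _ _; transitivity (gsum (fun x y =>
   if (x == p%:Z + a) && (y == q%:Z + b) then F' else 0)).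
  apply: eq_bigr => u _; by rewrite ![_ == _ - _]eq_sym !subr_eq.
apply: etrans (gsum_pick _ _ (fun _ _ => F')) _; case: ifP => // /negbT /sFT.
by rewrite /= !addrK.
Qed.

Lemma lsum_shift F v w c : supported F A ->
  supported (fun x y => F (x - w.1) (y - w.2)) A ->
  lsum (fun x y => F (x - w.1) (y - w.2)) v c
  = lsum F v (c - crd v w.1 w.2).
Proof.
move=> sF sFT; rewrite /lsum.
rewrite -[RHS](@gsum_shift w.1 w.2).
- by apply: eq_gsum => x y _; rewrite crdB (inj_eq (addIr _)).
- by move=> x y /sF ->; rewrite if_same.
- by move=> x y /sFT /= ->; rewrite if_same.
Qed.

Lemma eq_lsum F G v c : (forall x y, in_box A x y -> F x y = G x y) ->
  lsum F v c = lsum G v c.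
Proof. by move=> eqFG; apply: eq_gsum => x y /eqFG ->. Qed.

Lemma lsum_out F v c : `|v.1| * n%:Z + `|v.2| * m%:Z < `|c| -> lsum F v c = 0.
Proof.
move=> cW; apply: gsum0 => x y; rewrite /in_box /= => /and4P[? ? ? ?].
case: eqP => // eqc; suff : `|c| <= `|v.1| * n%:Z + `|v.2| * m%:Z by rewrite leNgt cW.
rewrite -eqc; apply: le_trans (ler_normB _ _) _; rewrite !normrM.
by apply: lerD; apply: ler_wpM2l => //; lia.
Qed.

End GridSum.

(** * Inverting the difference operator along a direction *)

Section Peel.
Variables (R : zmodType) (m n : nat).
Implicit Types F G : int -> int -> R.
Local Notation A := (grid_box m n).
Local Notation gsum := (gsum m n).
Local Notation lsum := (lsum m n).

Lemma gsumB F G : gsum (fun x y => F x y - G x y) = gsum F - gsum G.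
Proof. exact: sumrB. Qed.

Lemma lsumB F G v c :
  lsum (fun x y => F x y - G x y) v c = lsum F v c - lsum G v c.
Proof. by rewrite /lsum -gsumB; apply: eq_gsum => x y _; case: ifP; rewrite ?subr0. Qed.

(* Minus the sum of [F] over the points of the line through [(x, y)] up to
   [(x, y)], so that [F] is the difference of consecutive values. *)
Definition antidiff (v : int * int) F (x y : int) : R :=
  - gsum (fun x' y' => if (crd v x' y' == crd v x y)
                          && (dot v x' y' <= dot v x y)
                       then F x' y' else 0).

(** The two partial sums belong to consecutive points of a line, so that they differ by the single
    term at [(x, y)]. *)
Lemma antidiffK v F x y : primitive v -> supported F A ->
  antidiff v F (x - v.1) (y - v.2) - antidiff v F x y = F x y.
Proof.
move=> pv sF; rewrite /antidiff opprK addrC -gsumB.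
transitivity (gsum (fun x' y' => if (x' == x) && (y' == y) then F x' y' else 0)).
  apply: eq_gsum => x' y' _; rewrite crdB crd_self subr0 dotB.
  have nv := normv_gt0 pv.
  have [ec|nc] /= := eqVneq.
    have [t [-> ->]] := same_line pv ec; rewrite dotD.
    have [->|t0] := eqVneq t 0.
      rewrite !mul0r !addr0 !eqxx lexx /= ifF ?subr0 //; lia.
    have -> : (x + t * v.1 == x) && (y + t * v.2 == y) = false.
      apply/negP => /andP[/eqP e1 /eqP e2].
      have := dotD v x y t; rewrite e1 e2; nia.
    (* As [t] is a nonzero integer, both inequalities say that [t <= -1]. *)
    have -> : (dot v x y + t * dot v v.1 v.2 <= dot v x y - dot v v.1 v.2) =
              (dot v x y + t * dot v v.1 v.2 <= dot v x y) by nia.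
    by rewrite subrr.
  rewrite subrr; case: ifP => // /andP[/eqP e1 /eqP e2].
  by rewrite e1 e2 eqxx in nc.
by rewrite gsum_pick; case: ifP => // /negbT /sF.
Qed.

(** Outside of [shrink v B] the partial sum is trivial: either no point of the line up to [(x, y)]
    is in [B] and all terms vanish, or no later one is and the sum is the whole line sum. *)
Lemma supported_antidiff v F B : primitive v -> supported F B ->
  (forall c, lsum F v c = 0) -> supported (antidiff v F) (shrink v B).
Proof.
move=> pv sF ls0 x y; rewrite in_shrink => nB.
have nv := normv_gt0 pv.
pose P x' y' := [&& in_box B x' y', crd v x' y' == crd v x y & dot v x' y' <= dot v x y].
have [/existsP[[p q] /and3P[Bu /eqP uc ud]]|noP] :=
  boolP [exists u : grid m n, P (u.1 : nat)%:Z (u.2 : nat)%:Z]; last first.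
  rewrite /antidiff gsumE big1_seq ?oppr0 // => p /andP[_].
  rewrite mem_index_iota => /andP[_ lp].
  apply: big1_seq => q /andP[_]; rewrite mem_index_iota => /andP[_ lq].
  case: ifP => // /andP[c1 d1]; apply: sF; apply: contraNN noP => Bu.
  by apply/existsP; exists (Ordinal lp, Ordinal lq); apply/and3P.
apply/eqP; rewrite oppr_eq0; apply/eqP; rewrite -[RHS](ls0 (crd v x y)).
apply: eq_gsum => x' y' _.
case: eqP => //= c1; case: ifP => // /negbT d1.
symmetry; apply: sF; apply: contraNN nB => Bu'.
have [t [e1 e2]] := same_line pv (esym uc).
have [t' [e1' e2']] := same_line pv c1.
rewrite e1' e2' dotD -ltNge in d1.
have t'0 : 1 <= t' by nia.
have t0 : 0 <= t by rewrite e1 e2 dotD in ud; nia.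
have Bt : in_box B (x - t * v.1) (y - t * v.2) by rewrite e1 e2 !addrK.
have Bt' : in_box B (x + t' * v.1) (y + t' * v.2) by rewrite -e1' -e2'.
(* A point of [B] up to [(x, y)] and another one after it put, by convexity, both [(x, y)] and its
   successor in [B]. *)
apply/andP; split; first by apply: in_box_between Bt Bt' _ _ => //; lia.
apply: (@in_box_between _ v _ _ (t + 1) (t' - 1)) => //; [| |lia|lia].
  have e z w : z + w - (t + 1) * w = z - t * w by ring.
  by rewrite !e.
have e z w : z + w + (t' - 1) * w = z + t' * w by ring.
by rewrite !e.
Qed.

End Peel.

(** * The first points of the lines in a box *)

Definition is_rep (v : int * int) (B : box) (x y : int) : bool :=
  in_box B x y && ~~ in_box B (x - v.1) (y - v.2).

(** The function [r] of the overview. [L] is arbitrary, so that a table in the memory of the program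
    can take the place of the true line sums. *)
Definition rep_part (V : nmodType) (v : int * int) (B : box) (L : int -> V)
    (x y : int) : V :=
  if is_rep v B x y then L (crd v x y) else 0.

Section Representatives.
Variables (V : nmodType) (m n : nat) (v : int * int) (B : box).
Hypotheses (pv : primitive v) (sBA : sub_box B (grid_box m n)).

Lemma supported_rep_part (L : int -> V) : supported (rep_part v B L) B.
Proof. by move=> x y /negbTE nB; rewrite /rep_part /is_rep nB. Qed.

(** Given two distinct first points on a line, convexity would put the predecessor of the later one
    in [B]. *)
Lemma rep_unique x y x' y' : is_rep v B x y -> is_rep v B x' y' ->
  crd v x' y' = crd v x y -> (x' == x) && (y' == y).
Proof.
move=> r r' ec; have [t [e1 e2]] := same_line pv ec.
wlog t0 : x y x' y' r r' ec t e1 e2 / 0 <= t => [WL|].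
  have [/WL|t0] := leP 0 t; first exact.
  rewrite ![_ == x]eq_sym ![_ == y]eq_sym.
  by apply: (WL _ _ _ _ r' r (esym ec) (- t)); rewrite ?mulNr ?e1 ?e2 ?addrK // oppr_ge0 ltW.
have [t1|t1] := eqVneq t 0; first by rewrite e1 e2 t1 !mul0r !addr0 !eqxx.
case/andP: r => Bx _; case/andP: r' => Bx' /negP[].
apply: (@in_box_between _ v _ _ (t - 1) 1) => //; [| |lia].
  have e (z w : int) : z + t * w - w - (t - 1) * w = z by ring.
  by rewrite e1 e2 !e.
by rewrite !mul1r !subrK.
Qed.

(** The first point is reached by the largest number of steps back along [v] that lands in [B]. *)
Lemma rep_exists (x y : int) : in_box B x y ->
  exists x' y', is_rep v B x' y' /\ crd v x' y' = crd v x y.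
Proof.
move=> Bx; have := sBA Bx; rewrite /in_box /= => /and4P[x0 xm y0 yn].
have nv := normv_gt0 pv.
have e (z w k : int) : z - (w + 1) * k = z - w * k - k by ring.
pose P t := in_box B (x - t%:Z * v.1) (y - t%:Z * v.2).
have exP : exists t, P t by exists 0%N; rewrite /P !mul0r !subr0.
(* A nonzero coordinate of [v] bounds the number of steps by the corresponding side of the grid. *)
have bP t : P t -> (t <= m + n)%N.
  move/sBA; rewrite /in_box /= => /and4P[? ? ? ?].
  have bnd (z w : int) (k : nat) : 0 <= z -> z < k%:Z -> w != 0 ->
      0 <= z - t%:Z * w -> z - t%:Z * w < k%:Z -> (t <= k)%N.
    by move=> ? ? w0 ? ?; case: (ltgtP w 0) w0 => // ? _; nia.
  have [a0|a0] := eqVneq v.1 0; last first.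
    by apply: leq_trans (leq_addr _ _); apply: (@bnd x v.1).
  have [b0|b0] := eqVneq v.2 0; first by move: nv; rewrite /dot a0 b0.
  by apply: leq_trans (leq_addl _ _); apply: (@bnd y v.2).
case: (ex_maxnP exP bP) => t Pt tmax.
exists (x - t%:Z * v.1), (y - t%:Z * v.2); split; last first.
  by rewrite crdB; rewrite /crd; ring.
rewrite /is_rep -/(P t) Pt /= -!e; apply/negP => Pt1.
have /tmax : P t.+1 by rewrite /P -[t.+1]addn1 PoszD.
by rewrite ltnn.
Qed.

(** A line that meets [B] has exactly one first point, which carries the whole sum; on any other
    line both sides vanish. *)
Lemma lsum_rep_part (F : int -> int -> V) c : supported F B ->
  lsum m n (rep_part v B (lsum m n F v)) v c = lsum m n F v c.
Proof.
move=> sF; have sA x y : is_rep v B x y -> in_box (grid_box m n) x y.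
  by case/andP=> /sBA.
have [/existsP[u /andP[Bu /eqP uc]]|noB] :=
  boolP [exists u : grid m n, in_box B (u.1 : nat)%:Z (u.2 : nat)%:Z
                             && (crd v (u.1 : nat)%:Z (u.2 : nat)%:Z == c)].
  have [x0 [y0 [r0 c0]]] := rep_exists Bu; rewrite uc in c0.
  transitivity (gsum m n (fun x y => if (x == x0) && (y == y0)
                               then lsum m n F v (crd v x y) else 0)).
    apply: eq_gsum => x y _; rewrite /rep_part; case: ifP => [/eqP ec|nc].
      case: ifP => [r|]; first by rewrite (rep_unique r0 r) ?ec.
      by case: ifP => // /andP[/eqP -> /eqP ->]; rewrite r0.
    by case: ifP => // /andP[/eqP ex /eqP ey]; rewrite ex ey c0 eqxx in nc.
  by rewrite gsum_pick sA // c0.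
have noB' x y : in_box (grid_box m n) x y -> in_box B x y -> crd v x y != c.
  case/and4P=> /= x_ge0 lp y_ge0 lq; case: x x_ge0 lp => [p|p] // _ lp.
  case: y y_ge0 lq => [q|q] // _ lq Bx; apply: contraNneq noB => ec.
  rewrite !ltz_nat in lp lq.
  by apply/existsP; exists (Ordinal lp, Ordinal lq); rewrite /= Bx ec eqxx.
rewrite /lsum !gsum0 // => x y Ax; case: ifP => // ec.
  by apply: sF; apply/negP => /(noB' _ _ Ax); rewrite ec.
rewrite /rep_part; case: ifP => // /andP[/(noB' _ _ Ax)].
by rewrite ec.
Qed.
End Representatives.

(** * Counting points of the grid *)

Definition grid_count (m n : nat) (P : int -> int -> bool) : nat :=
  gsum m n (fun x y => P x y : nat).

Lemma grid_count_le (m n : nat) P : (grid_count m n P <= m * n)%N.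
Proof.
have -> : (m * n = \sum_(u : grid m n) 1)%N by rewrite sum1_card card_prod !card_ord.
by apply: leq_sum => u _; case: P.
Qed.

Lemma grid_countE (m n : nat) P :
  grid_count m n P = (\sum_(0 <= p < m) \sum_(0 <= q < n) P p%:Z q%:Z)%N.
Proof. exact: gsumE. Qed.

(** Translation by [v] maps [shrink v B] onto the points of [B] that are not first on their
    lines. *)
Lemma count_rep (m n : nat) v B : sub_box B (grid_box m n) ->
  (grid_count m n (is_rep v B) + grid_count m n (in_box (shrink v B))
   = grid_count m n (in_box B))%N.
Proof.
move=> sBA; rewrite /grid_count -[X in (_ + X)%N](@gsum_shift _ m n v.1 v.2).
- rewrite -[(_ + _)%N]gsumD; apply: eq_gsum => x y _.
  rewrite in_shrink !subrK /is_rep.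
  by case: in_box; case: in_box.
- by move=> x y; rewrite in_shrink; case: (boolP (in_box B x y)) => // /sBA ->.
- move=> x y; rewrite in_shrink !subrK andbC.
  by case: (boolP (in_box B x y)) => // /sBA ->.
Qed.

(** * The sequence of quotients *)

Section Rounds.
Variables (V : comPzRingType) (m n e : nat) (w : nat -> int * int).
Variable f : int -> int -> V.
Local Notation A := (grid_box m n).
Local Notation gsum := (gsum m n).
Local Notation lsum := (lsum m n).

(* Rounds are numbered downwards: round [k] uses the direction [w k] and leads
   from [box_at k.+1] and [quot_at k.+1] to [box_at k] and [quot_at k]. *)
Fixpoint nth_box (i : nat) : box :=
  if i is j.+1 then shrink (w (e - i)) (nth_box j) else A.

Definition box_at (k : nat) : box := nth_box (e - k).

Definition residue (v : int * int) (B : box) (F : int -> int -> V) x y : V :=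
  F x y - rep_part v B (lsum F v) x y.

Fixpoint nth_quot (i : nat) : int -> int -> V :=
  if i is j.+1 then
    antidiff m n (w (e - i)) (residue (w (e - i)) (nth_box j) (nth_quot j))
  else f.

Definition quot_at (k : nat) : int -> int -> V := nth_quot (e - k).

Definition part_at (k : nat) : int -> int -> V :=
  rep_part (w k) (box_at k.+1) (lsum (quot_at k.+1) (w k)).

(** The recurrence that rebuilds [quot_at k.+1] from [quot_at k], started from [0] in place of
    [quot_at 0]. *)
Fixpoint sol_at (k : nat) : int -> int -> V :=
  if k is j.+1 then fun x y =>
    part_at j x y + sol_at j (x - (w j).1) (y - (w j).2) - sol_at j x y
  else fun _ _ => 0.

Lemma box_at_top : box_at e = A.
Proof. by rewrite /box_at subnn. Qed.

Lemma quot_at_top : quot_at e = f.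
Proof. by rewrite /quot_at subnn. Qed.

Lemma box_at_step k : (k < e)%N -> box_at k = shrink (w k) (box_at k.+1).
Proof.
move=> ke; rewrite /box_at subnS -(prednK (_ : 0 < e - k)%N) ?subn_gt0 //=.
by rewrite prednK ?subn_gt0 // subKn // ltnW.
Qed.

Lemma quot_at_step k : (k < e)%N -> quot_at k
  = antidiff m n (w k) (residue (w k) (box_at k.+1) (quot_at k.+1)).
Proof.
move=> ke; rewrite /quot_at /box_at subnS -(prednK (_ : 0 < e - k)%N) ?subn_gt0 //=.
by rewrite prednK ?subn_gt0 // subKn // ltnW.
Qed.

Lemma sub_box_at k : sub_box (box_at k) A.
Proof.
rewrite /box_at; elim: (e - k)%N => [|i IH] x y //=.
by rewrite in_shrink => /andP[/IH].
Qed.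

Hypothesis w_primitive : forall k, (k < e)%N -> primitive (w k).
Hypothesis f_supported : supported f A.

Lemma supported_residue v B F : supported F B -> supported (residue v B F) B.
Proof.
by move=> sF x y nB; rewrite /residue sF // supported_rep_part // subr0.
Qed.

Lemma sub_supported (W : nmodType) (F : int -> int -> W) B B' :
  sub_box B B' -> supported F B -> supported F B'.
Proof. by move=> sB sF x y nB; apply: sF; apply: contra nB => /sB. Qed.

(** Downward induction on [k]: the residue has zero line sums in the direction [w k], so its
    antidifference lives on the shrunken box. *)
Lemma supported_quot_at k : (k <= e)%N -> supported (quot_at k) (box_at k).
Proof.
move=> ke; rewrite -(subKn ke); elim: (e - k)%N (leq_subr k e) => [|i IH] ie.
  by rewrite subn0 quot_at_top box_at_top.
have ke1 : (e - i.+1 < e)%N by lia.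
rewrite quot_at_step // (box_at_step ke1).
have eS : ((e - i.+1).+1 = e - i)%N by lia.
rewrite eS; have {}IH := IH (ltnW ie).
apply: supported_antidiff; [exact: w_primitive|exact: supported_residue|].
move=> c; rewrite lsumB lsum_rep_part ?subrr //; first exact: w_primitive.
exact: sub_box_at.
Qed.

Lemma quot_atE k x y : (k < e)%N ->
  quot_at k (x - (w k).1) (y - (w k).2) - quot_at k x y
  = quot_at k.+1 x y - part_at k x y.
Proof.
move=> ke; rewrite quot_at_step // antidiffK //; first exact: w_primitive.
exact: sub_supported (@sub_box_at k.+1) (supported_residue _ (supported_quot_at _)).
Qed.

Lemma supported_shift (F : int -> int -> V) k : (k < e)%N -> supported F (box_at k) ->
  supported (fun x y => F (x - (w k).1) (y - (w k).2)) (box_at k.+1).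
Proof.
by move=> ke sF x y nB; apply: sF; rewrite box_at_step // in_shrink !subrK (negbTE nB) andbF.
Qed.

Lemma sub_box_atS k : (k < e)%N -> sub_box (box_at k) (box_at k.+1).
Proof. by move=> ke x y; rewrite box_at_step // in_shrink => /andP[]. Qed.

Lemma supported_sol_at k : (k <= e)%N -> supported (sol_at k) (box_at k).
Proof.
elim: k => [|k IH] //= ke x y nB.
rewrite (supported_shift ke (IH (ltnW ke)) nB).
rewrite (sub_supported (sub_box_atS ke) (IH (ltnW ke)) nB).
by rewrite /part_at supported_rep_part // !addr0 subr0.
Qed.

(** Line sums of the identity [quot_atE]. For a direction [v] with nonzero shift this recurrence,
    started from the zeros far out, determines the sums of [quot_at k]. *)
Lemma lsum_quot_at k v c : (k < e)%N ->
  lsum (quot_at k) v c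
  = lsum (quot_at k) v (c - crd v (w k).1 (w k).2)
    - (lsum (quot_at k.+1) v c - lsum (part_at k) v c).
Proof.
move=> ke; rewrite -lsumB.
have sq := supported_quot_at (ltnW ke).
rewrite -lsum_shift; first last.
- exact: sub_supported (@sub_box_at k.+1) (supported_shift ke sq).
- exact: sub_supported (@sub_box_at k) sq.
rewrite -lsumB; apply: eq_lsum => x y _.
by rewrite -quot_atE // opprB addrCA subrr addr0.
Qed.

Definition err_at k x y := quot_at k x y - sol_at k x y.

Lemma supported_err_at k : (k <= e)%N -> supported (err_at k) (box_at k).
Proof.
by move=> ke x y nB; rewrite /err_at supported_quot_at // supported_sol_at // subr0.
Qed.

(** The terms [part_at k] cancel, which leaves a homogeneous recurrence. *)
Lemma err_atS k x y : (k < e)%N ->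
  err_at k.+1 x y = err_at k (x - (w k).1) (y - (w k).2) - err_at k x y.
Proof.
move=> ke; have := quot_atE x y ke; rewrite /err_at /= => /eqP.
rewrite eq_sym subr_eq => /eqP ->; ring.
Qed.

(** [err_at k.+1] is a difference along [w k], so its sums in that direction cancel; the other
    directions follow by induction. *)
Lemma lsum_err_at k h c : (h < k)%N -> (k <= e)%N ->
  lsum (err_at k) (w h) c = 0.
Proof.
elim: k c => [|k IH] c // hk ke.
have se := supported_err_at (ltnW ke).
rewrite (eq_lsum _ _ (fun x y _ => err_atS x y ke)) lsumB.
rewrite lsum_shift; first last.
- exact: sub_supported (@sub_box_at k.+1) (supported_shift ke se).
- exact: sub_supported (@sub_box_at k) se.
move: hk; rewrite ltnS leq_eqVlt => /orP[/eqP->|hk].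
  by rewrite crd_self subr0 subrr.
by rewrite !IH ?subrr // ltnW.
Qed.

Lemma err_at_empty k x y : (forall x y, ~~ in_box (box_at 0) x y) ->
  (k <= e)%N -> err_at k x y = 0.
Proof.
move=> nb; elim: k x y => [|k IH] x y ke; first exact: supported_err_at.
by rewrite err_atS // !IH ?subrr // ltnW.
Qed.

(** The widths may be negative; the last box is recognised as empty by a width that is at most
    [0]. *)
Lemma box_at_width : let B := box_at 0 in
  B.1.2 - B.1.1 = m%:Z - (\sum_(0 <= h < e) `|(w h).1|)%N%:Z /\
  B.2.2 - B.2.1 = n%:Z - (\sum_(0 <= h < e) `|(w h).2|)%N%:Z.
Proof.
suff H k : (k <= e)%N -> let B := box_at k in
    B.1.2 - B.1.1 = m%:Z - (\sum_(k <= h < e) `|(w h).1|)%N%:Z /\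
    B.2.2 - B.2.1 = n%:Z - (\sum_(k <= h < e) `|(w h).2|)%N%:Z by exact: H.
move=> ke; rewrite -(subKn ke); elim: (e - k)%N (leq_subr k e) => [|i IH] ie.
  by rewrite subn0 box_at_top !big_geq //= !subr0.
have ke1 : (e - i.+1 < e)%N by lia.
have eS : ((e - i.+1).+1 = e - i)%N by lia.
rewrite !(big_ltn ke1) box_at_step // eS /=.
have /= [] := IH (ltnW ie).
case: box_at => [[x0 x1] [y0 y1]]; case: (w _) => a b /=.
by case: (ltrP a 0); case: (ltrP b 0) => ? ?; lia.
Qed.

(** By [count_rep] the sum telescopes: the first points of a round are as many as the points lost by
    the box. *)
Lemma sum_count_rep :
  (\sum_(0 <= k < e) grid_count m n (is_rep (w k) (box_at k.+1)) <= m * n)%N.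
Proof.
suff H k : (k <= e)%N ->
    (\sum_(0 <= h < k) grid_count m n (is_rep (w h) (box_at h.+1))
     + grid_count m n (in_box (box_at 0)) = grid_count m n (in_box (box_at k)))%N.
  by have := H e (leqnn e); have := grid_count_le m n (in_box (box_at e)); lia.
elim: k => [|k IH] ke; first by rewrite big_geq.
rewrite big_nat_recr //=; have := count_rep (w k) (@sub_box_at k.+1).
by rewrite -box_at_step //; have := IH (ltnW ke); lia.
Qed.
End Rounds.

(** * Running times and postconditions of programs *)

Fixpoint zwrites (c : cmd) : seq nat :=
  match c with
  | Skip | RSet _ _ _ _ => [::]
  | ZSet x _ _ _ => [:: x]
  | Seq c1 c2 | If _ c1 c2 => zwrites c1 ++ zwrites c2
  | While _ c1 => zwrites c1
  end.

Fixpoint rwrites (c : cmd) : seq nat :=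
  match c with
  | Skip | ZSet _ _ _ _ => [::]
  | RSet x _ _ _ => [:: x]
  | Seq c1 c2 | If _ c1 c2 => rwrites c1 ++ rwrites c2
  | While _ c1 => rwrites c1
  end.

Definition zput (R : Type) (s : state R) x i j a : state R :=
  State (upd (zmem s) x i j a) (rmem s).

Definition rput (R : Type) (s : state R) x i j a : state R :=
  State (zmem s) (upd (rmem s) x i j a).

Definition zvar (x : nat) : zexp := ZGet x (ZConst 0) (ZConst 0).

Definition zlet (x : nat) (e : zexp) : cmd := ZSet x (ZConst 0) (ZConst 0) e.

Definition for_loop (x : nat) (hi : zexp) (c : cmd) : cmd :=
  Seq (zlet x (ZConst 0))
      (While (BZlt (zvar x) hi) (Seq c (zlet x (ZAdd (zvar x) (ZConst 1))))).

Section Memory.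
Variables (R : Type) (s : state R).

Lemma zput_same x i j a : zmem (zput s x i j a) x i j = a.
Proof. by rewrite /= /upd !eqxx. Qed.

Lemma zput_other x i j a y i' j' : y != x ->
  zmem (zput s x i j a) y i' j' = zmem s y i' j'.
Proof. by rewrite /= /upd => /negbTE ->. Qed.

Lemma zput_neq x i j a y i' j' : i' != i ->
  zmem (zput s x i j a) y i' j' = zmem s y i' j'.
Proof. by rewrite /= /upd => /negbTE ->; rewrite andbF. Qed.

Lemma rput_same x i j a : rmem (rput s x i j a) x i j = a.
Proof. by rewrite /= /upd !eqxx. Qed.

Lemma rput_other x i j a y i' j' : y != x ->
  rmem (rput s x i j a) y i' j' = rmem s y i' j'.
Proof. by rewrite /= /upd => /negbTE ->. Qed.

Lemma rputE x i j a i' j' : rmem (rput s x i j a) x i' j'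
  = if (i' == i) && (j' == j) then a else rmem s x i' j'.
Proof. by rewrite /= /upd eqxx. Qed.

Lemma rmem_zput x i j a : rmem (zput s x i j a) = rmem s.
Proof. by []. Qed.

Lemma zmem_rput x i j a : zmem (rput s x i j a) = zmem s.
Proof. by []. Qed.

End Memory.

Arguments zmem : simpl never.
Arguments rmem : simpl never.

(* Array names are numerals, so that [isT] proves [y != x] by computation. *)
Ltac mem_simpl := rewrite ?rmem_zput ?zmem_rput; repeat (first [
    match goal with |- context [zmem (zput ?s ?x ?i ?j ?a) ?x ?i ?j] =>
      rewrite (zput_same s x i j a) end
  | match goal with |- context [zmem (zput ?s ?x ?i ?j ?a) ?y ?i' ?j'] =>
      rewrite (@zput_other _ s x i j a y i' j' isT) end
  | match goal with |- context [rmem (rput ?s ?x ?i ?j ?a) ?x ?i ?j] =>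
      rewrite (rput_same s x i j a) end
  | match goal with |- context [rmem (rput ?s ?x ?i ?j ?a) ?y ?i' ?j'] =>
      rewrite (@rput_other _ s x i j a y i' j' isT) end ];
  rewrite ?rmem_zput ?zmem_rput).

(** * Total correctness with time budgets *)

Section WeakestPrecondition.
Variable R : realType.
Implicit Types (s : state R) (Q : state R -> Prop).

Lemma exec_frame c s t s' : exec c s t s' ->
  (forall x i j, x \notin zwrites c -> zmem s' x i j = zmem s x i j) /\
  (forall x i j, x \notin rwrites c -> rmem s' x i j = rmem s x i j).
Proof.
elim=> {c s t s'} //=.
- move=> x i j e s; split=> // y i' j'; rewrite inE => /negbTE nyx.
  by rewrite /zmem /rmem /upd /= nyx.
- move=> x i j e s; split=> // y i' j'; rewrite inE => /negbTE nyx.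
  by rewrite /zmem /rmem /upd /= nyx.
- move=> c1 c2 s t1 s1 t2 s2 _ [z1 r1] _ [z2 r2].
  by split=> x i j; rewrite mem_cat negb_or => /andP[n1 n2]; rewrite ?z2 ?z1 ?r2 ?r1.
- move=> b c1 c2 s t s1 _ _ [z1 r1].
  by split=> x i j; rewrite mem_cat negb_or => /andP[n1 n2]; rewrite ?z1 ?r1.
- move=> b c1 c2 s t s1 _ _ [z1 r1].
  by split=> x i j; rewrite mem_cat negb_or => /andP[n1 n2]; rewrite ?z1 ?r1.
- move=> b c s t1 s1 t2 s2 _ _ [z1 r1] _ [z2 r2].
  by split=> x i j nx; rewrite ?z2 ?z1 ?r2 ?r1.
Qed.

Definition wp s c T Q : Prop := exists t s', [/\ exec c s t s', (t <= T)%N & Q s'].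

Lemma wp_weaken T' Q' s c T Q : wp s c T' Q' -> (T' <= T)%N ->
  (forall s', Q' s' -> Q s') -> wp s c T Q.
Proof.
case=> t [s' [ex le_t q]] le_T impl; exists t, s'.
by split; [|exact: leq_trans le_T|exact: impl].
Qed.

Lemma wp_frame s c T Q : wp s c T
    (fun s' =>
      (forall x i j, x \notin zwrites c -> zmem s' x i j = zmem s x i j) ->
      (forall x i j, x \notin rwrites c -> rmem s' x i j = rmem s x i j) -> Q s') ->
  wp s c T Q.
Proof.
by case=> t [s' [ex le_t q]]; exists t, s'; have [? ?] := exec_frame ex; split=> //; apply: q.
Qed.

Lemma wp_skip s T Q : Q s -> wp s Skip T Q.
Proof. by move=> q; exists 0%N, s; split=> //; constructor. Qed.

Lemma wp_zset i0 j0 a s x i j e T Q :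
  zeval s i = i0 -> zeval s j = j0 -> zeval s e = a ->
  (zcost i + zcost j + zcost e < T)%N ->
  Q (zput s x i0 j0 a) -> wp s (ZSet x i j e) T Q.
Proof. by move=> <- <- <- le_T q; do 2!eexists; split; first exact: ExecZSet. Qed.

Lemma wp_let a s x e T Q : zeval s e = a -> (zcost e + 2 < T)%N ->
  Q (zput s x 0 0 a) -> wp s (zlet x e) T Q.
Proof. by move=> ea le_T; apply: wp_zset ea _ => //=; rewrite addnC. Qed.

Lemma wp_rset i0 j0 a s x i j e T Q :
  zeval s i = i0 -> zeval s j = j0 -> reval s e = a ->
  (zcost i + zcost j + rcost e < T)%N ->
  Q (rput s x i0 j0 a) -> wp s (RSet x i j e) T Q.
Proof. by move=> <- <- <- le_T q; do 2!eexists; split; first exact: ExecRSet. Qed.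

Lemma wp_seq T1 T2 s c1 c2 T Q : (T1 + T2 <= T)%N ->
  wp s c1 T1 (fun s1 => wp s1 c2 T2 Q) -> wp s (Seq c1 c2) T Q.
Proof.
move=> le_T [t1 [s1 [ex1 le1 [t2 [s2 [ex2 le2 q]]]]]].
exists (t1 + t2)%N, s2; split=> //; first exact: ExecSeq ex1 ex2.
exact: leq_trans (leq_add le1 le2) le_T.
Qed.

Lemma wp_if T1 s b c1 c2 T Q : (bcost b + T1 <= T)%N ->
  (beval s b -> wp s c1 T1 Q) -> (~~ beval s b -> wp s c2 T1 Q) ->
  wp s (If b c1 c2) T Q.
Proof.
move=> le_T; have [bs /(_ isT) + _|bs _ /(_ isT)] := boolP (beval s b);
  case=> t [s' [ex le_t q]]; exists (bcost b + t)%N, s'; split=> //.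
- exact: ExecIfTrue.
- by apply: leq_trans le_T; rewrite leq_add2l.
- exact: ExecIfFalse.
- by apply: leq_trans le_T; rewrite leq_add2l.
Qed.

(** The bound [hi] is evaluated again before each iteration, so the invariant must fix its value.
    The 40 covers the test (at most 24) and the increment (8). *)
Lemma wp_for (I : nat -> state R -> Prop) (T : nat -> nat) N s x hi c T' Q :
  x \notin zwrites c -> (zcost hi <= 20)%N ->
  (\sum_(0 <= i < N) (T i + 40) + 40 <= T')%N ->
  (forall i s', (i <= N)%N -> I i s' -> zeval s' hi = N%:Z) ->
  (forall i s', (i < N)%N -> zmem s' x 0 0 = i%:Z -> I i s' ->
    wp s' c (T i) (fun s2 => I i.+1 (zput s2 x 0 0 i.+1%:Z))) ->
  I 0%N (zput s x 0 0 0) -> (forall s', I N s' -> Q s') ->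
  wp s (for_loop x hi c) T' Q.
Proof.
move=> nx hi20 le_T' Ihi Ibody I0 IQ.
(* Induction on the number [k] of iterations that remain. *)
suff loop k s0 : (k <= N)%N -> zmem s0 x 0 0 = (N - k)%N%:Z -> I (N - k)%N s0 ->
    wp s0 (While (BZlt (zvar x) hi) (Seq c (zlet x (ZAdd (zvar x) (ZConst 1)))))
      (\sum_(N - k <= i < N) (T i + 40) + 30)%N Q.
  apply: (@wp_seq 10 (\sum_(0 <= i < N) (T i + 40) + 30)); first by lia.
  apply: (@wp_let 0) => //; have := loop N (zput s x 0 0 0).
  by rewrite subnn; apply; rewrite ?zput_same.
elim: k s0 => [|k IH] s0 kN xk Ik.
  rewrite subn0 in Ik xk.
  eexists; eexists; split; [apply: ExecWhileFalse| |exact: IQ Ik].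
    by rewrite /= xk (Ihi _ _ (leqnn N) Ik) ltxx.
  by rewrite /=; lia.
have lt_kN : (N - k.+1 < N)%N by lia.
have eS : ((N - k.+1).+1 = N - k)%N by lia.
have [t [s1 [ex le_t I1]]] := Ibody _ _ lt_kN xk Ik.
have [fz _] := exec_frame ex.
rewrite eS in I1.
have xk1 : zmem (zput s1 x 0 0 (N - k)%N) x 0 0 = (N - k)%N%:Z by rewrite zput_same.
have [t2 [s2 [ex2 le_t2 q]]] := IH _ (ltnW kN) xk1 I1.
exists (bcost (BZlt (zvar x) hi) + (t + 8) + t2)%N, s2; split=> //.
  apply: ExecWhileTrue ex2; first by rewrite /= xk (Ihi _ _ (ltnW lt_kN) Ik).
  apply: ExecSeq ex _; rewrite /zput.
  have -> : (N - k)%N%:Z = zeval s1 (ZAdd (zvar x) (ZConst 1)).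
    by rewrite /= fz // xk -eS -addn1 PoszD.
  exact: ExecZSet.
by rewrite big_ltn //= eS; lia.
Qed.

End WeakestPrecondition.

(** * Choosing the directions *)

Notation "e1 |+| e2" := (ZAdd e1 e2) (at level 50, left associativity).
Notation "e1 |-| e2" := (ZSub e1 e2) (at level 50, left associativity).
Notation "e1 |*| e2" := (ZMul e1 e2) (at level 40, left associativity).
Notation "c1 ;; c2" := (Seq c1 c2) (at level 70, right associativity).
Notation "# k" := (ZConst k) (at level 5).
Notation "x <~ e" := (zlet x e) (at level 60).

Definition entry (x : nat) (i : zexp) : zexp := ZGet x i (# 0).
Definition dir1 (h : zexp) : zexp := ZGet 1 h (# 0).
Definition dir2 (h : zexp) : zexp := ZGet 1 h (# 1).
Definition in_m : zexp := ZGet 0 (# 0) (# 0).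
Definition in_n : zexp := ZGet 0 (# 1) (# 0).
Definition in_d : zexp := ZGet 0 (# 2) (# 0).

(* Integer arrays: [aW] at [(h, 0)] is an upper bound of [`|c|] for the lines of
   the h-th direction that meet the grid; [aX0], [aX1], [aY0], [aY1] at [(k, 0)]
   are the bounds of [box_at k].  The other names are those of
   integer scalars.  Real array 0 is updated in place, 2 is auxiliary. *)
Definition aW := 2%N.
Definition aX0 := 3%N.
Definition aX1 := 4%N.
Definition aY0 := 5%N.
Definition aY1 := 6%N.
Definition ve := 10%N.
Definition vM := 11%N.
Definition vN := 12%N.
Definition vt := 13%N.
Definition vi := 14%N.
Definition vk := 15%N.
Definition vp := 16%N.
Definition vq := 17%N.
Definition vh := 18%N.
Definition vd := 19%N.
Definition vs := 20%N.
Definition vj := 21%N.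
Definition vc := 22%N.

Definition let_abs (x : nat) (e : zexp) : cmd :=
  If (BZlt e (# 0)) (x <~ # 0 |-| e) (x <~ e).

(** There is no early exit: once [vM] or [vN] is no longer positive, the remaining iterations only
    test the guard. *)
Definition scan_body : cmd :=
  If (BAnd (BZlt (# 0) (zvar vM)) (BZlt (# 0) (zvar vN)))
     (let_abs vt (dir1 (zvar vh)) ;;
      vM <~ zvar vM |-| zvar vt ;;
      ZSet aW (zvar vh) (# 0) (zvar vt |*| in_n) ;;
      let_abs vt (dir2 (zvar vh)) ;;
      vN <~ zvar vN |-| zvar vt ;;
      ZSet aW (zvar vh) (# 0) (entry aW (zvar vh) |+| zvar vt |*| in_m) ;;
      ve <~ zvar vh |+| # 1)
     Skip.

Definition scan : cmd :=
  ve <~ # 0 ;; vM <~ in_m ;; vN <~ in_n ;; for_loop vh in_d scan_body.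

Section Scan.
Variables (R : realType) (m n : nat) (D : seq (int * int)).
Local Notation d := (size D).
Local Notation w := (nth 0 D).

Definition width (v : int * int) : nat := (`|v.1| * n + `|v.2| * m)%N.
Definition sum1 (e : nat) : nat := (\sum_(0 <= h < e) `|(w h).1|)%N.
Definition sum2 (e : nat) : nat := (\sum_(0 <= h < e) `|(w h).2|)%N.

Definition inputs (s : state R) : Prop :=
  [/\ zmem s 0 0 0 = m%:Z, zmem s 0 1 0 = n%:Z, zmem s 0 2 0 = d%:Z &
      forall h, (h < d)%N -> zmem s 1 h%:Z 0 = (w h).1 /\ zmem s 1 h%:Z 1 = (w h).2].

Definition scanned (e : nat) (s : state R) : Prop :=
  zmem s ve 0 0 = e%:Z /\
  forall h, (h < e)%N -> zmem s aW h%:Z 0 = (width (w h))%:Z.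

(** Only the directions before the last selected one have bounded sums; the last one may be
    arbitrarily long, which is why it is treated first. *)
Definition scan_spec (i e : nat) : Prop :=
  [/\ (e <= i)%N, (0 < e)%N -> (sum1 e.-1 < m)%N /\ (sum2 e.-1 < n)%N &
      e = i \/ (m <= sum1 e)%N \/ (n <= sum2 e)%N].

Lemma wp_let_abs a (s : state R) x e T Q : `|zeval s e|%N = a ->
  (4 * zcost e + 10 <= T)%N ->
  Q (zput s x 0 0 a) -> wp s (let_abs x e) T Q.
Proof.
move=> <- le_T q; apply: (@wp_if _ (zcost e + 7)).
- by rewrite /=; lia.
- move=> /= neg; apply: wp_let q; last by rewrite /=; lia.
  by rewrite /=; lia.
- move=> /= pos; apply: wp_let q; last by rewrite /=; lia.
  by rewrite /=; lia.
Qed.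

Lemma sum1S e : sum1 e.+1 = (sum1 e + `|(w e).1|)%N.
Proof. by rewrite /sum1 big_nat_recr. Qed.

Lemma sum2S e : sum2 e.+1 = (sum2 e + `|(w e).2|)%N.
Proof. by rewrite /sum2 big_nat_recr. Qed.

Definition scan_inv (i : nat) (s : state R) : Prop := inputs s /\
  exists e, [/\ scan_spec i e, scanned e s, zmem s vM 0 0 = m%:Z - (sum1 e)%:Z &
       zmem s vN 0 0 = n%:Z - (sum2 e)%:Z].

Lemma scan_body_correct i (s : state R) : (i < d)%N ->
  zmem s vh 0 0 = i%:Z -> scan_inv i s ->
  wp s scan_body 200 (scan_inv i.+1).
Proof.
move=> id hi [[im inn idd iD] [e [[ei ee ec] [we wW] eM eN]]].
apply: (@wp_if _ 180); [by []|move=> /= /andP[M0 N0]|]; last first.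
  move=> /= neg; apply: wp_skip; split=> //; exists e; split=> //.
  split=> //; first exact: leqW.
  by move: neg; rewrite eM eN; lia.
(* Both remaining widths are positive, so no direction has been rejected so far. *)
have eqe : e = i by rewrite eM eN in M0 N0; lia.
subst e; have [i1 i2] := iD _ id.
apply: (@wp_seq _ 30 150); first by [].
apply: (@wp_let_abs `|(w i).1|%N); [by rewrite /= hi i1|by []|].
apply: (@wp_seq _ 12 130); first by [].
apply: (@wp_let _ (m%:Z - (sum1 i.+1)%:Z)); [|by []|].
  by rewrite /=; mem_simpl; rewrite eM sum1S PoszD opprD addrA.
apply: (@wp_seq _ 18 110); first by [].
apply: (@wp_zset _ i%:Z 0 (`|(w i).1| * n)%N%:Z); [| | |by []|].
- by rewrite /=; mem_simpl.
- by [].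
- by rewrite /=; mem_simpl; rewrite inn.
apply: (@wp_seq _ 30 80); first by [].
apply: (@wp_let_abs `|(w i).2|%N); [by rewrite /=; mem_simpl; rewrite hi i2|by []|].
apply: (@wp_seq _ 12 60); first by [].
apply: (@wp_let _ (n%:Z - (sum2 i.+1)%:Z)); [|by []|].
  by rewrite /=; mem_simpl; rewrite eN sum2S PoszD opprD addrA.
apply: (@wp_seq _ 30 15); first by [].
apply: (@wp_zset _ i%:Z 0 (width (w i))%:Z); [| | |by []|].
- by rewrite /=; mem_simpl.
- by [].
- by rewrite /=; mem_simpl; rewrite hi; mem_simpl; rewrite im.
apply: (@wp_let _ i.+1%:Z); [|by []|].
  by rewrite /=; mem_simpl; rewrite hi -addn1 PoszD.
split=> //; exists i.+1; split.
- split=> //; [|by left].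
  by rewrite eM eN in M0 N0 => _ /=; lia.
- split=> [|h]; first by mem_simpl.
  rewrite ltnS leq_eqVlt => /orP[/eqP->|hi1]; mem_simpl => //.
  by do 2!(rewrite zput_neq ?eqz_nat ?ltn_eqF //; mem_simpl); exact: wW.
- by mem_simpl.
- by mem_simpl.
Qed.

Lemma scan_correct (s : state R) : inputs s ->
  wp s scan (240 * d + 100) (fun s' => inputs s' /\
    exists e, scan_spec d e /\ scanned e s').
Proof.
move=> ins; have [im inn idd iD] := ins.
apply: (@wp_seq _ 10 (240 * d + 90)); first by lia.
apply: (@wp_let _ 0) => //.
apply: (@wp_seq _ 10 (240 * d + 80)); first by lia.
apply: (@wp_let _ m%:Z) => //.
apply: (@wp_seq _ 10 (240 * d + 70)); first by lia.
apply: (@wp_let _ n%:Z) => //.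
apply: (@wp_for _ scan_inv (fun _ => 200%N) d) => //.
- by rewrite sum_nat_const_nat; lia.
- by move=> i s' _ [[]].
- move=> i s' id hi Hi.
  by apply: wp_weaken (scan_body_correct id hi Hi) _ _.
- split=> //; exists 0%N; split; mem_simpl => //; last first.
  + by rewrite /sum2 big_geq // subr0.
  + by rewrite /sum1 big_geq // subr0.
  by split=> //; left.
- by move=> s' [ins' [e [? ? _ _]]]; split=> //; exists e.
Qed.
End Scan.

(** * The boxes *)

Definition next_k : zexp := zvar vk |+| # 1.

Definition shrink_interval (x0 x1 : nat) (a : zexp) : cmd :=
  If (BZlt a (# 0))
     (ZSet x0 (zvar vk) (# 0) (entry x0 next_k |-| a) ;;
      ZSet x1 (zvar vk) (# 0) (entry x1 next_k))
     (ZSet x0 (zvar vk) (# 0) (entry x0 next_k) ;;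
      ZSet x1 (zvar vk) (# 0) (entry x1 next_k |-| a)).

(** The loop counter [vi] increases while the rounds are numbered downwards. *)
Definition set_round : cmd := vk <~ zvar ve |-| # 1 |-| zvar vi.

Definition boxes_body : cmd :=
  set_round ;;
  shrink_interval aX0 aX1 (dir1 (zvar vk)) ;;
  shrink_interval aY0 aY1 (dir2 (zvar vk)).

Definition boxes : cmd :=
  ZSet aX0 (zvar ve) (# 0) (# 0) ;; ZSet aX1 (zvar ve) (# 0) in_m ;;
  ZSet aY0 (zvar ve) (# 0) (# 0) ;; ZSet aY1 (zvar ve) (# 0) in_n ;;
  for_loop vi (zvar ve) boxes_body.

Section Boxes.
Variables (R : realType) (m n : nat) (D : seq (int * int)) (e : nat).
Local Notation w := (nth 0 D).
Local Notation box_at := (box_at m n e w).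
Implicit Types s : state R.
Hypothesis e_le : (e <= size D)%N.

Definition boxed (k0 : nat) s : Prop := forall k, (k0 <= k <= e)%N ->
  [/\ zmem s aX0 k%:Z 0 = (box_at k).1.1, zmem s aX1 k%:Z 0 = (box_at k).1.2,
      zmem s aY0 k%:Z 0 = (box_at k).2.1 & zmem s aY1 k%:Z 0 = (box_at k).2.2].

(** For [v >= 0] the expression [a] is evaluated again after the write to [x0], which therefore must
    not affect its value. *)
Lemma wp_shrink_interval s x0 x1 a k l r v T Q :
  x1 != x0 -> vk != x0 -> vk != x1 ->
  zmem s vk 0 0 = k%:Z -> zmem s x0 k.+1%:Z 0 = l -> zmem s x1 k.+1%:Z 0 = r ->
  zeval s a = v -> (forall l', zeval (zput s x0 k%:Z 0 l') a = v) ->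
  (3 * zcost a + 60 <= T)%N ->
  Q (zput (zput s x0 k%:Z 0 (if v < 0 then l - v else l)) x1 k%:Z 0
      (if v < 0 then r else r - v)) ->
  wp s (shrink_interval x0 x1 a) T Q.
Proof.
move=> n10 nk0 nk1 ek el er av av' le_T q.
have kS : k%:Z + 1 = k.+1%:Z by rewrite -addn1 PoszD.
apply: (@wp_if _ (2 * zcost a + 50)); first by rewrite /=; lia.
- rewrite /= av => neg; rewrite neg in q.
  apply: (@wp_seq _ (zcost a + 20) 20); first by lia.
  apply: (@wp_zset _ k%:Z 0 (l - v)) => //=; [|by lia|].
    by rewrite ek kS el av.
  by apply: (@wp_zset _ k%:Z 0 r) => //=; rewrite !zput_other // ek ?kS.
- rewrite /= av => /negbTE neg; rewrite neg in q.
  apply: (@wp_seq _ 20 (zcost a + 20)); first by lia.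
  apply: (@wp_zset _ k%:Z 0 l) => //=; first by rewrite ek kS el.
  apply: (@wp_zset _ k%:Z 0 (r - v)) => //=; [| |by lia].
    by rewrite zput_other.
  by rewrite !zput_other // ek kS er av'.
Qed.

Lemma wp_set_round s i T Q : zmem s ve 0 0 = e%:Z -> zmem s vi 0 0 = i%:Z ->
  (i < e)%N -> (12 <= T)%N -> Q (zput s vk 0 0 (e - i.+1)%N%:Z) ->
  wp s set_round T Q.
Proof.
move=> ee ei ie le_T q; apply: (wp_let (a := (e - i.+1)%N%:Z)) => //.
by rewrite /= ee ei; clear e_le; lia.
Qed.

Definition boxes_inv (i : nat) s : Prop :=
  [/\ inputs m n D s, scanned m n D e s & boxed (e - i) s].

Lemma boxes_body_correct i s : (i < e)%N -> zmem s vi 0 0 = i%:Z ->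
  boxes_inv i s -> wp s boxes_body 300 (boxes_inv i.+1).
Proof.
move=> ie hi [[im inn idd iD] [we wW] bx].
set k := (e - i.+1)%N; have ke : (k < e)%N by rewrite /k; lia.
have kS : (k.+1 = e - i)%N by rewrite /k; lia.
have [k1 k2] := iD k (leq_trans ke e_le).
have rS : (e - i <= k.+1 <= e)%N by rewrite kS leqnn leq_subr.
have [b1 b2 b3 b4] := bx _ rS.
apply: (@wp_seq _ 20 280) => //; apply: (wp_set_round we hi) => //.
apply: (@wp_seq _ 120 150) => //.
apply: (@wp_shrink_interval _ _ _ _ k (box_at k.+1).1.1 (box_at k.+1).1.2
  (w k).1) => //=; mem_simpl => //.
apply: (@wp_shrink_interval _ _ _ _ k (box_at k.+1).2.1 (box_at k.+1).2.2
  (w k).2) => //=; mem_simpl => //.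
split=> //.
move=> k' /andP[lo hi']; move: lo; rewrite leq_eqVlt => /orP[/eqP ek|lo].
  by rewrite -ek -/k; mem_simpl; rewrite (box_at_step _ _ _ ke).
have nk : k'%:Z != k%:Z by rewrite eqz_nat gtn_eqF.
have r' : (e - i <= k' <= e)%N by rewrite -kS lo hi'.
have [c1 c2 c3 c4] := bx _ r'.
by split; mem_simpl; rewrite (zput_neq _ _ _ _ _ _ nk); mem_simpl.
Qed.

Definition setup s : Prop := [/\ inputs m n D s, scanned m n D e s & boxed 0 s].

Lemma boxes_correct s : inputs m n D s -> scanned m n D e s ->
  wp s boxes (340 * e + 200) setup.
Proof.
move=> ins sc; have [im inn idd iD] := ins; have [we wW] := sc.
apply: (@wp_seq _ 10 (340 * e + 190)); first by lia.
apply: (@wp_zset _ e%:Z 0 0) => //.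
apply: (@wp_seq _ 10 (340 * e + 180)); first by lia.
apply: (@wp_zset _ e%:Z 0 m%:Z) => //.
apply: (@wp_seq _ 10 (340 * e + 170)); first by lia.
apply: (@wp_zset _ e%:Z 0 0) => //.
apply: (@wp_seq _ 10 (340 * e + 160)); first by lia.
apply: (@wp_zset _ e%:Z 0 n%:Z) => //.
apply: (@wp_for _ boxes_inv (fun _ => 300%N) e) => //.
- by rewrite sum_nat_const_nat; lia.
- by move=> i s' _ [_ []].
- by move=> i s' ie hi Hi; apply: wp_weaken (boxes_body_correct ie hi Hi) _ _.
- split=> // k; rewrite subn0 -eqn_leq => /eqP<-; rewrite box_at_top.
  by split; mem_simpl.
- by move=> s' [ins' sc' bx]; split=> //; move: bx; rewrite subnn.
Qed.

End Boxes.

(** * The line sums of the quotients *)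

Definition e_in_box (x y : zexp) : bexp :=
  BAnd (BAnd (BNot (BZlt x (entry aX0 next_k))) (BZlt x (entry aX1 next_k)))
       (BAnd (BNot (BZlt y (entry aY0 next_k))) (BZlt y (entry aY1 next_k))).

Definition e_is_rep : bexp :=
  BAnd (e_in_box (zvar vp) (zvar vq))
       (BNot (e_in_box (zvar vp |-| dir1 (zvar vk)) (zvar vq |-| dir2 (zvar vk)))).

Definition e_crd (h : zexp) : zexp := dir1 h |*| zvar vq |-| dir2 h |*| zvar vp.

(** At a first point, the value of [r] is removed from the sums of the lines through this point in
    the directions [h < k], those still to be used. *)
Definition subtract_at : cmd :=
  for_loop vh (zvar vk)
    (RSet 0 (zvar vh) (e_crd (zvar vh))
       (RSub (RGet 0 (zvar vh) (e_crd (zvar vh)))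
             (RGet 0 (zvar vk) (e_crd (zvar vk))))).

Definition subtract_part : cmd :=
  for_loop vp in_m (for_loop vq in_n (If e_is_rep subtract_at Skip)).

(** The recurrence of [lsum_quot_at], in place: [c] runs over [[-W, W]] upwards or downwards
    according to the sign of the shift. *)
Definition divide_step : cmd :=
  vc <~ (zvar vj |-| entry aW (zvar vh)) |*| zvar vs ;;
  RSet 0 (zvar vh) (zvar vc)
    (RSub (RGet 0 (zvar vh) (zvar vc |-| zvar vd)) (RGet 0 (zvar vh) (zvar vc))).

Definition divide_body : cmd :=
  vd <~ dir1 (zvar vh) |*| dir2 (zvar vk) |-| dir2 (zvar vh) |*| dir1 (zvar vk) ;;
  If (BZlt (zvar vd) (# 0)) (vs <~ # (-1)) (vs <~ # 1) ;;
  for_loop vj (# 2 |*| entry aW (zvar vh) |+| # 1) divide_step.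

Definition divide : cmd := for_loop vh (zvar vk) divide_body.

Definition forward : cmd :=
  for_loop vi (zvar ve) (set_round ;; subtract_part ;; divide).

Section Forward.
Variables (R : realType) (m n : nat) (D : seq (int * int)) (e : nat).
Local Notation w := (nth 0 D).
Local Notation box_at := (box_at m n e w).
Local Notation setup := (setup m n D e).
Local Notation width := (width m n).
Local Notation lsum := (lsum m n).
Implicit Types s : state R.
Hypotheses (e_le : (e <= size D)%N) (D_dirs : direction_set D).

Lemma w_prim k : (k < e)%N -> primitive (w k).
Proof.
by move=> ke; case/andP: D_dirs => /allP/(_ _ (mem_nth 0 (leq_trans ke e_le))).
Qed.

Lemma crd_w_neq0 h k : (h < k)%N -> (k < e)%N -> crd (w h) (w k).1 (w k).2 != 0.
Proof.
move=> hk ke; have he := ltn_trans hk ke.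
case/andP: (D_dirs) => _ /(pairwiseP 0) pw.
have /andP[] := pw h k (leq_trans he e_le) (leq_trans ke e_le) hk.
by apply: crd_neq0; exact: w_prim.
Qed.

Lemma beval_in_box s k x y (ex ey : zexp) : setup s -> (k < e)%N ->
  zmem s vk 0 0 = k%:Z -> zeval s ex = x -> zeval s ey = y ->
  beval s (e_in_box ex ey) = in_box (box_at k.+1) x y.
Proof.
move=> [_ _ bx] ke ek exx eyy; have [b1 b2 b3 b4] := bx _ ke.
have kS : k%:Z + 1 = k.+1%:Z by rewrite -addn1 PoszD.
by rewrite /= ek kS b1 b2 b3 b4 exx eyy -!leNgt /in_box !andbA.
Qed.

Lemma beval_is_rep s k (p q : nat) : setup s -> (k < e)%N ->
  zmem s vk 0 0 = k%:Z -> zmem s vp 0 0 = p%:Z -> zmem s vq 0 0 = q%:Z ->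
  beval s e_is_rep = is_rep (w k) (box_at k.+1) p%:Z q%:Z.
Proof.
move=> st ke ek ep eq; have [[_ _ _ iD] _ _] := st.
have [d1 d2] := iD _ (leq_trans ke e_le).
have -> : beval s e_is_rep = beval s (e_in_box (zvar vp) (zvar vq)) &&
  ~~ beval s (e_in_box (zvar vp |-| dir1 (zvar vk)) (zvar vq |-| dir2 (zvar vk))) by [].
rewrite !(beval_in_box st ke ek (erefl _) (erefl _)).
by rewrite /= ek ep eq d1 d2.
Qed.

Lemma zeval_crd s h (p q : nat) (eh : zexp) : setup s -> (h < e)%N ->
  zeval s eh = h%:Z -> zmem s vp 0 0 = p%:Z -> zmem s vq 0 0 = q%:Z ->
  zeval s (e_crd eh) = crd (w h) p%:Z q%:Z.
Proof.
move=> [[_ _ _ iD] _ _] he eeh ep eq; have [d1 d2] := iD _ (leq_trans he e_le).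
by rewrite /= eeh ep eq d1 d2.
Qed.

Definition sums_are (L : nat -> int -> R) s : Prop :=
  forall h c, rmem s 0 h%:Z c = L h c.

Section Round.
Variables (k : nat) (ke : (k < e)%N).

Definition round_state s := setup s /\ zmem s vk 0 0 = k%:Z.

Lemma subtract_at_correct s (p q : nat) (L : nat -> int -> R) :
  round_state s -> zmem s vp 0 0 = p%:Z -> zmem s vq 0 0 = q%:Z ->
  sums_are L s ->
  wp s subtract_at (140 * k + 40)
    (fun s' => [/\ round_state s', zmem s' vp 0 0 = p%:Z, zmem s' vq 0 0 = q%:Z &
      sums_are (fun h c => L h c - (if (h < k)%N && (crd (w h) p%:Z q%:Z == c)
                                    then L k (crd (w k) p%:Z q%:Z) else 0)) s']).
Proof.
move=> st ep eq sL.
apply: (@wp_for _ (fun i s' =>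
    [/\ round_state s', zmem s' vp 0 0 = p%:Z, zmem s' vq 0 0 = q%:Z &
      sums_are (fun h c => L h c - (if (h < i)%N && (crd (w h) p%:Z q%:Z == c)
                                    then L k (crd (w k) p%:Z q%:Z) else 0)) s'])
  (fun _ => 100%N) k) => //.
- by rewrite sum_nat_const_nat; lia.
- by move=> i s' _ [[]].
- move=> i s' ik ei [[st' ek'] ep' eq' sL'].
  have ie := ltn_trans ik ke.
  have eci : zeval s' (e_crd (zvar vh)) = crd (w i) p%:Z q%:Z by exact: zeval_crd.
  have eck : zeval s' (e_crd (zvar vk)) = crd (w k) p%:Z q%:Z by exact: zeval_crd.
  apply: (@wp_rset _ i%:Z (crd (w i) p%:Z q%:Z)
    (L i (crd (w i) p%:Z q%:Z) - L k (crd (w k) p%:Z q%:Z))) => //.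
    have -> (x y : rexp) : reval s' (RSub x y) = reval s' x - reval s' y by [].
    have re z c : reval s' (RGet 0 z c) = rmem s' 0 (zeval s' z) (zeval s' c) by [].
    rewrite !re eci eck /= ei ek' !sL' !ltnn !andFb !subr0.
    (* Only rows below [k] change, so that row [k] still holds the value to be subtracted. *)
    by rewrite ltnNge (ltnW ik) subr0.
  split=> // h c; rewrite rmem_zput rputE eqz_nat sL' ltnS.
  have [->|nhi] := eqVneq h i.
    rewrite ltnn leqnn /= eq_sym; case: eqP => [<-|_] //; by rewrite subr0.
  by rewrite /= [(h <= i)%N]leq_eqVlt (negbTE nhi).
- by split=> // h c; rewrite rmem_zput sL subr0.
Qed.

Definition partial_lsum (F : int -> int -> R) v c (p : nat) : R :=
  \sum_(0 <= p' < p) \sum_(0 <= q < n)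
    if crd v p'%:Z q%:Z == c then F p'%:Z q%:Z else 0.

Definition part_of (L : nat -> int -> R) : int -> int -> R :=
  rep_part (w k) (box_at k.+1) (L k).

(** All points of the grid are tested, but only first points incur a cost linear in [k]; hence the
    term with [grid_count]. *)
Lemma subtract_part_correct s (L : nat -> int -> R) :
  round_state s -> sums_are L s ->
  wp s subtract_part
    (400 * m * n + (140 * k + 40) * grid_count m n (is_rep (w k) (box_at k.+1)) + 80 * m + 40)
    (fun s' => round_state s' /\ sums_are (fun h c => L h c
       - (if (h < k)%N then lsum (part_of L) (w h) c else 0)) s').
Proof.
move=> st sL; pose F := part_of L.
(* [ps] collects the complete columns before [p], and [pt] the visited part of column [p]. *)
pose ps p h c := if (h < k)%N then partial_lsum F (w h) c p else 0.
pose pt (p q h : nat) c := if (h < k)%N then \sum_(0 <= q' < q)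
    (if crd (w h) p%:Z q'%:Z == c then F p%:Z q'%:Z else 0) else 0.
pose r (p q : nat) : nat := is_rep (w k) (box_at k.+1) p%:Z q%:Z.
apply: (@wp_for _ (fun p s' => round_state s' /\
  sums_are (fun h c => L h c - ps p h c) s')
  (fun p => \sum_(0 <= q < n) (240 + (140 * k + 40) * r p q + 40) + 40)%N m) => //.
- have -> : grid_count m n (is_rep (w k) (box_at k.+1))
      = (\sum_(0 <= p < m) \sum_(0 <= q < n) r p q)%N by exact: grid_countE.
  rewrite big_distrr /= !big_split /= !sum_nat_const_nat.
  under eq_bigr => p _ do rewrite !big_split /= !sum_nat_const_nat -big_distrr /=.
  rewrite !big_split /= !sum_nat_const_nat; lia.
- by move=> i s' _ [[[[]]]].
- move=> p s' pm ep [st' sL'].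
  apply: (@wp_for _ (fun q s' => [/\ round_state s', zmem s' vp 0 0 = p%:Z &
    sums_are (fun h c => L h c - ps p h c - pt p q h c) s'])
    (fun q => 240 + (140 * k + 40) * r p q)%N n) => //.
  + by move=> i s2 _ [[[[]]]].
  + move=> q s2 qn eq [st2 ep2 sL2].
    have ptS h c : pt p q.+1 h c = pt p q h c + (if (h < k)%N &&
        (crd (w h) p%:Z q%:Z == c) then F p%:Z q%:Z else 0).
      rewrite /pt; case: ifP => _; last by rewrite addr0.
      by rewrite big_nat_recr.
    have erep := beval_is_rep st2.1 ke st2.2 ep2 eq.
    have [rpq|nr] := boolP (beval s2 e_is_rep).
      rewrite erep in rpq; rewrite /r rpq muln1.
      apply: (@wp_if _ (140 * k + 40)) => [||]; first by rewrite /=; lia.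
        move=> _; apply: wp_weaken (subtract_at_correct st2 ep2 eq sL2) (leqnn _) _.
        move=> s3 [st3 ep3 eq3 sL3]; split=> // h c; rewrite rmem_zput sL3 ptS opprD addrA.
        congr (_ - _); rewrite /F /part_of /rep_part rpq /ps /pt ltnn !subr0.
        by [].
      by rewrite erep rpq.
    apply: (@wp_if _ 0) => [||]; first by rewrite /=; lia.
      by rewrite (negbTE nr).
    move=> _; apply: wp_skip; split=> // h c; rewrite rmem_zput sL2 ptS.
    by rewrite /F /part_of /rep_part -erep (negbTE nr) if_same addr0.
  + by split=> // h c; rewrite rmem_zput sL' /pt big_geq // if_same subr0.
  + move=> s2 [st2 ep2 sL2]; split=> // h c; rewrite rmem_zput sL2 -addrA -opprD.
    congr (_ - _); rewrite /ps /pt /partial_lsum; case: ifP => _; last by rewrite addr0.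
    by rewrite big_nat_recr.
- by split=> // h c; rewrite rmem_zput sL /ps /partial_lsum big_geq // if_same subr0.
- move=> s' [st' sL']; split=> // h c; rewrite sL' /ps /partial_lsum.
  by case: ifP => // _; rewrite /lsum gsumE.
Qed.

(** * Solving the recurrence for the line sums in place *)

Section Divide.
Variables L Lq : nat -> int -> R.
Hypothesis L_out : forall h c, (h < k)%N -> (width (w h))%:Z < `|c| -> L h c = 0.
Hypothesis Lq_out : forall h c, (h < k)%N -> (width (w h))%:Z < `|c| -> Lq h c = 0.
Hypothesis LqE : forall h c, (h < k)%N ->
  Lq h c = Lq h (c - crd (w h) (w k).1 (w k).2) - L h c.

Definition div_state (h : nat) (sg : int) s :=
  [/\ round_state s, zmem s vh 0 0 = h%:Z,
      zmem s vd 0 0 = crd (w h) (w k).1 (w k).2 & zmem s vs 0 0 = sg].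

(* [sg] is the sign of the shift, so that the cells read by [divide_step] have
   already been replaced. *)
Definition div_inv (h : nat) (sg : int) (j : nat) s :=
  div_state h sg s /\ sums_are (fun h' c =>
    if (h' < h)%N || ((h' == h) && (sg * c + (width (w h))%:Z < j%:Z))
    then Lq h' c else L h' c) s.

Lemma divide_step_correct h sg j s : (h < k)%N -> sg * sg = 1 ->
  0 < sg * crd (w h) (w k).1 (w k).2 ->
  zmem s vj 0 0 = j%:Z -> div_inv h sg j s ->
  wp s divide_step 60 (div_inv h sg j.+1).
Proof.
move=> hk sg2 sgd ej [[[[ins [we wW] bx] ek] eh ed es] sL].
have he := ltn_trans hk ke.
set W := (width (w h))%:Z in sL *; set dl := crd (w h) _ _ in ed sgd.
pose c0 := (j%:Z - W) * sg.
have sc0 : sg * c0 + W = j by rewrite /c0 mulrC -mulrA sg2; ring.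
apply: (@wp_seq _ 25 35) => //.
apply: (@wp_let _ c0) => //=; first by rewrite ej eh wW // es.
apply: (@wp_rset _ h%:Z c0 (Lq h c0)) => //.
  have -> (x y : rexp) s' : reval s' (RSub x y) = reval s' x - reval s' y by [].
  have re z c s' : reval s' (RGet 0 z c) = rmem s' 0 (zeval s' z) (zeval s' c) by [].
  rewrite !re /=; mem_simpl; rewrite eh ed !sL ltnn eqxx /= sc0 ltxx.
  have -> : sg * (c0 - dl) + W < j by rewrite mulrBr -sc0; lia.
  by rewrite -LqE.
split=> // h' c; rewrite rputE rmem_zput sL eqz_nat.
have [->|nh] := eqVneq h' h; last by [].
rewrite ltnn /=; have [->|nc] := eqVneq c c0; first by rewrite sc0 ltz_nat leqnn.
(* As [sg * sg = 1], [c0] is the only cell whose position in the order is [j]. *)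
have ncj : sg * c + W != j.
  apply: contra nc => /eqP ecj; rewrite -[c]mul1r -sg2 -mulrA /c0 -ecj.
  by apply/eqP; ring.
by rewrite -addn1 PoszD; congr (if _ then _ else _); move: ncj; set u := _ + _; lia.
Qed.

Lemma divide_body_correct h s : (h < k)%N -> round_state s ->
  zmem s vh 0 0 = h%:Z ->
  sums_are (fun h' c => if (h' < h)%N then Lq h' c else L h' c) s ->
  wp s divide_body (200 * width (w h) + 240)
    (fun s' => round_state s' /\
       sums_are (fun h' c => if (h' < h.+1)%N then Lq h' c else L h' c) s').
Proof.
move=> hk [st ek] eh sL; have [[im inn idd iD] [we wW] bx] := st.
have he := ltn_trans hk ke.
have [h1 h2] := iD _ (leq_trans he e_le); have [k1 k2] := iD _ (leq_trans ke e_le).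
set W := width (w h); set dl := crd (w h) (w k).1 (w k).2.
pose sg : int := if dl < 0 then -1 else 1.
have sg2 : sg * sg = 1 by rewrite /sg; case: ifP.
have sgd : 0 < sg * dl.
  have := crd_w_neq0 hk ke; rewrite /sg -/dl.
  by case: (ltrP dl 0) => dl0; rewrite ?mulN1r ?mul1r; lia.
(* Cells outside of [[-W, W]] are zero in both tables, so they fit the invariant at the start and
   the end of the loop. *)
have scW (c j : int) : sg * c + W%:Z < 0 \/ 2 * W%:Z + 1 <= sg * c + W%:Z ->
    W%:Z < `|c|.
  by rewrite /sg; case: ifP => _; rewrite ?mulN1r ?mul1r; lia.
apply: (@wp_seq _ 30 (200 * W + 200)); first by lia.
apply: (@wp_let _ dl) => //=; first by rewrite eh ek h1 h2 k1 k2.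
apply: (@wp_seq _ 20 (200 * W + 180)); first by lia.
set s1 := zput _ _ _ _ _.
have wp_sg : wp s1 (If (BZlt (zvar vd) (# 0)) (vs <~ # (-1)) (vs <~ # 1)) 20
    (fun s2 => s2 = zput s1 vs 0 0 sg).
  by apply: (@wp_if _ 6) => //; rewrite /=; mem_simpl => neg; apply: (@wp_let _ sg);
     rewrite //= /sg ?neg ?(negbTE neg).
apply: wp_weaken wp_sg _ _ => // _ ->.
apply: (@wp_for _ (div_inv h sg) (fun _ => 60%N) (2 * W).+1) => //.
- by rewrite sum_nat_const_nat; lia.
- move=> j s' _ [[[[_ [_ wW'] _] _] eh' _ _] _]; rewrite /= eh' wW' // -/W; lia.
- by move=> j s' _ ej Hj; apply: divide_step_correct.
- split=> // h' c; rewrite !rmem_zput sL.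
  case: (eqVneq h' h) => [->|_]; last by rewrite orbF.
  rewrite ltnn /=; case: ifP => // neg.
  by rewrite L_out ?Lq_out //; apply: scW; left.
- move=> s' [[st' _ _ _] sL']; split=> // h' c; rewrite sL' ltnS [(h' <= h)%N]leq_eqVlt.
  have [->|_] := eqVneq h' h; last by rewrite /= orbF.
  rewrite ltnn /=; case: ifP => // /negbT pos.
  by rewrite L_out ?Lq_out //; apply: scW; right; move: pos; rewrite -leNgt -addn1 PoszD PoszM.
Qed.

Lemma divide_correct s : round_state s -> sums_are L s ->
  wp s divide (\sum_(0 <= h < k) (200 * width (w h) + 280) + 40)
    (fun s' => round_state s' /\
       sums_are (fun h c => if (h < k)%N then Lq h c else L h c) s').
Proof.
move=> st sL.
apply: (@wp_for _ (fun h s' => round_state s' /\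
    sums_are (fun h' c => if (h' < h)%N then Lq h' c else L h' c) s')
  (fun h => 200 * width (w h) + 240)%N k) => //.
- by rewrite leq_add2r; apply: leq_sum => h _; rewrite -addnA.
- by move=> i s' _ [[]].
- move=> h s' hk eh [st' sL'].
  exact: wp_weaken (divide_body_correct hk st' eh sL') _ _.
Qed.

End Divide.

End Round.

Variable f : int -> int -> R.
Hypothesis f_supported : supported f (grid_box m n).
Local Notation quot := (quot_at m n e w f).
Local Notation part := (part_at m n e w f).
Local Notation count k := (grid_count m n (is_rep (w k) (box_at k.+1))).

(* The sums for direction [h] are left unchanged from round [h] on, where they
   are those of [quot_at h.+1]; the backward pass reads [part_at h] from them. *)
Definition sums_at (k : nat) s := forall h c, (h < e)%N ->
  rmem s 0 h%:Z c = lsum (quot (maxn h.+1 k)) (w h) c.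

Lemma lsum_out_width F (v : int * int) c : (width v)%:Z < `|c| ->
  lsum F v c = 0 :> R.
Proof. by rewrite /width PoszD !PoszM !abszE; apply: lsum_out. Qed.

Definition round_time (k : nat) : nat :=
  (400 * m * n + (140 * k + 40) * count k + 80 * m
   + \sum_(0 <= h < k) (200 * width (w h) + 280) + 120)%N.

Lemma round_correct i s : (i < e)%N -> zmem s vi 0 0 = i%:Z ->
  setup s -> sums_at (e - i) s ->
  wp s (set_round ;; subtract_part ;; divide) (round_time (e - i.+1))
    (fun s' => setup s' /\ sums_at (e - i.+1) s').
Proof.
move=> ie ei st sf; set k := (e - i.+1)%N; have ke : (k < e)%N by rewrite /k; lia.
have kS : (e - i = k.+1)%N by rewrite /k; lia.
rewrite kS in sf; have [ins [we wW] bx] := st.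
apply: (@wp_seq _ 20 (round_time k - 20)); first by rewrite /round_time; lia.
apply: (wp_set_round we ei) => //; rewrite -/k.
pose L h c := rmem s 0 h%:Z c.
(* At this moment row [k] holds the sums of [quot_at k.+1], so that the program subtracts the
   intended part. *)
have partE x y : part_of k L x y = part k x y.
  by rewrite /part_of /part_at /rep_part /L sf // maxnn.
apply: (@wp_seq _ (400 * m * n + (140 * k + 40) * count k + 80 * m + 40)
  (\sum_(0 <= h < k) (200 * width (w h) + 280) + 40)); first by rewrite /round_time; lia.
have st1 : round_state k (zput s vk 0 0 k) by [].
apply: wp_weaken (subtract_part_correct ke st1 (L := L) _) _ _ => //.
move=> s1 [st1' sL1]; set L1 := (fun h c => _) in sL1.
have L1E h c : (h < k)%N -> L1 h c = lsum (quot k.+1) (w h) c - lsum (part k) (w h) c.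
  move=> hk; rewrite /L1 hk /L sf ?(ltn_trans hk) // (maxn_idPr _) ?ltnS ?(ltnW hk) //.
  by congr (_ - _); apply: eq_lsum => x y _; exact: partE.
apply: wp_weaken (divide_correct ke (L := L1)
  (Lq := fun h => lsum (quot k) (w h)) _ _ _ st1' sL1) _ _ => //.
- by move=> h c hk Wc; rewrite L1E // !lsum_out_width // subrr.
- by move=> h c hk Wc; rewrite lsum_out_width.
- by move=> h c hk; rewrite L1E //; apply: lsum_quot_at => //; exact: w_prim.
- move=> s2 [[st2 _] sL2]; split=> // h c he; rewrite sL2.
  case: ltnP => [hk|kh]; first by rewrite (maxn_idPr _).
  (* For [h >= k] the row is untouched, and [maxn h.+1 k] and [maxn h.+1 k.+1] are both [h.+1]. *)
  by rewrite /L1 ltnNge kh subr0 /L sf // !(maxn_idPl _) // ltnW.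
Qed.

(** * The linear time bound of the forward pass *)

Hypotheses (m_gt0 : (0 < m)%N) (n_gt0 : (0 < n)%N).
Hypothesis e_spec : scan_spec m n D (size D) e.

Lemma width_gt0 v : primitive v -> (0 < width v)%N.
Proof.
case: v => a b; rewrite /primitive /coprimez /width /= => prim.
have [a0|a0] := eqVneq a 0; last by rewrite addn_gt0 muln_gt0 absz_gt0 a0 n_gt0.
rewrite addn_gt0 muln_gt0 absz_gt0 [in X in _ || X]muln_gt0 absz_gt0 m_gt0 andbT.
by apply/orP; right; apply: contraTneq prim => b0; rewrite a0 b0.
Qed.

(** From [h < k < e] follows [h < e.-1], where the stopping rule bounds the coordinate sums by [m]
    and [n]; hence the widths add up to at most [2mn]. As each width is positive, [480] times the
    width absorbs the constant [280], and [960 = 2 * 480]. *)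
Lemma sum_width k : (k < e)%N ->
  (\sum_(0 <= h < k) (200 * width (w h) + 280) <= 960 * (m * n))%N.
Proof.
move=> ke; have e0 : (0 < e)%N by apply: leq_ltn_trans ke.
have [_ /(_ e0)[s1 s2] _] := e_spec.
apply: (@leq_trans (\sum_(0 <= h < k) 480 * width (w h))%N).
  rewrite !big_nat; apply: leq_sum => h /andP[_ hk].
  by have := width_gt0 (w_prim (ltn_trans hk ke)); lia.
rewrite -big_distrr /=.
have -> : (\sum_(0 <= h < k) width (w h) = sum1 D k * n + sum2 D k * m)%N.
  by rewrite /sum1 /sum2 !big_distrl -big_split.
have mono (F : nat -> nat) : (\sum_(0 <= h < k) F h <= \sum_(0 <= h < e.-1) F h)%N.
  have ke1 : (k <= e.-1)%N by rewrite -ltnS prednK.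
  by rewrite (big_cat_nat (leq0n k) ke1) leq_addr.
have l1 : (sum1 D k <= m)%N by apply: leq_trans (mono _) (ltnW s1).
have l2 : (sum2 D k <= n)%N by apply: leq_trans (mono _) (ltnW s2).
have := leq_mul l1 (leqnn n); have := leq_mul l2 (leqnn m); lia.
Qed.

(** Per round, [400 + 80 + 960 + 160 = 1600] bounds all costs but those of the first points; the
    latter are at most [180 d] each, for at most [mn] points over all rounds. *)
Lemma sum_round_time :
  (\sum_(0 <= i < e) (round_time (e - i.+1) + 40) + 40
   <= 2000 * (size D * m * n) + 100)%N.
Proof.
apply: (@leq_trans (\sum_(0 <= i < e)
  (1600 * (m * n) + 180 * size D * count (e - i.+1)) + 40)%N).
  rewrite leq_add2r !big_nat; apply: leq_sum => i /andP[_ ie].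
  have ke : (e - i.+1 < e)%N by lia.
  have := sum_width ke; rewrite /round_time.
  have := leq_pmulr m n_gt0.
  have m1n1 : (0 < m * n)%N by rewrite muln_gt0 m_gt0.
  have kd : (140 * (e - i.+1) + 40 <= 180 * size D)%N by lia.
  by have := leq_mul kd (leqnn (count (e - i.+1))); lia.
rewrite big_split /= sum_nat_const_nat subn0 -big_distrr /=.
have -> : (\sum_(0 <= i < e) count (e - i.+1) = \sum_(0 <= k < e) count k)%N.
  by rewrite [RHS]big_nat_rev.
have l1 := leq_mul e_le (leqnn (m * n)%N).
have l2 := leq_mul (leqnn (size D)) (sum_count_rep m n e w); lia.
Qed.

Lemma forward_correct s : setup s -> sums_at e s ->
  wp s forward (2000 * (size D * m * n) + 100)
    (fun s' => setup s' /\ sums_at 0 s').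
Proof.
move=> st sf.
apply: (@wp_for _ (fun i s' => setup s' /\ sums_at (e - i) s')
  (fun i => round_time (e - i.+1)) e) => //; first exact: sum_round_time.
- by move=> i s' _ [[_ [we _] _] _].
- by move=> i s' ie ei [st' sf']; exact: round_correct.
- by split=> //; rewrite subn0.
- by move=> s' [st' sf']; split=> //; rewrite subnn in sf'.
Qed.

End Forward.

(** * The reconstruction *)

Definition grid_loop (c : cmd) : cmd := for_loop vp in_m (for_loop vq in_n c).

(** Old values are read at two points, so new ones go to array 2 first. Reads outside of the grid
    return [0], the correct value of [sol_at] there. *)
Definition next_value : cmd :=
  RSet 2 (zvar vp) (zvar vq)
    (RSub (RGet 1 (zvar vp |-| dir1 (zvar vk)) (zvar vq |-| dir2 (zvar vk)))
          (RGet 1 (zvar vp) (zvar vq))) ;;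
  If e_is_rep
     (RSet 2 (zvar vp) (zvar vq)
        (RAdd (RGet 2 (zvar vp) (zvar vq)) (RGet 0 (zvar vk) (e_crd (zvar vk)))))
     Skip.

Definition copy_value : cmd :=
  RSet 1 (zvar vp) (zvar vq) (RGet 2 (zvar vp) (zvar vq)).

Definition backward : cmd :=
  for_loop vk (zvar ve) (grid_loop next_value ;; grid_loop copy_value).

Definition reconstruct : cmd := scan ;; boxes ;; forward ;; backward.

Section Backward.
Variables (R : realType) (m n : nat) (D : seq (int * int)) (e : nat).
Local Notation w := (nth 0 D).
Local Notation A := (grid_box m n).
Local Notation box_at := (box_at m n e w).
Local Notation setup := (setup m n D e).
Local Notation lsum := (lsum m n).
Implicit Types s : state R.
Hypotheses (e_le : (e <= size D)%N) (D_dirs : direction_set D).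
Variable f : int -> int -> R.
Hypotheses (m_gt0 : (0 < m)%N) (n_gt0 : (0 < n)%N).
Local Notation sol := (sol_at m n e w f).
Local Notation sums_at := (sums_at m n D e f).

(* The points visited by [grid_loop] before the point [(p, q)]. *)
Definition visited (p q : nat) (x y : int) : bool :=
  in_box A x y && ((x < p%:Z) || ((x == p%:Z) && (y < q%:Z))).

Lemma visitedS p q x y : (p < m)%N -> (q < n)%N ->
  visited p q.+1 x y = visited p q x y || ((x == p%:Z) && (y == q%:Z)).
Proof. by rewrite /visited /in_box /= => ? ?; lia. Qed.

Lemma visited_row p x y : visited p n x y = visited p.+1 0 x y.
Proof. by rewrite /visited /in_box /=; lia. Qed.

(** The invariant is indexed by the set of visited points, up to extensional equality, which
    identifies the end of a column with the start of the next. *)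
Lemma wp_grid_loop (I : (int -> int -> bool) -> state R -> Prop) c T s T' Q :
  vp \notin zwrites c -> vq \notin zwrites c ->
  (m * (n * (T + 40) + 80) + 40 <= T')%N ->
  (forall P P' s, P =2 P' -> I P s -> I P' s) ->
  (forall P s, I P s -> inputs m n D s) ->
  (forall x P s a, x \in [:: vp; vq] -> I P s -> I P (zput s x 0 0 a)) ->
  (forall p q s, (p < m)%N -> (q < n)%N -> zmem s vp 0 0 = p%:Z ->
     zmem s vq 0 0 = q%:Z -> I (visited p q) s ->
     wp s c T (I (fun x y => visited p q x y || ((x == p%:Z) && (y == q%:Z))))) ->
  I (fun _ _ => false) s -> (forall s', I (in_box A) s' -> Q s') ->
  wp s (grid_loop c) T' Q.
Proof.
move=> np nq le_T' Iext Iin Ivar Ibody I0 IQ.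
apply: (@wp_for _ (fun p => I (visited p 0)) (fun _ => n * (T + 40) + 40)%N m) => //.
- by rewrite /= inE mem_cat inE (negbTE np).
- by rewrite sum_nat_const_nat; lia.
- by move=> i s' _ /Iin[].
- move=> p s' pm ep Ip.
  apply: (@wp_for _ (fun q s2 => I (visited p q) s2 /\ zmem s2 vp 0 0 = p%:Z)
    (fun _ => T) n) => //.
  + by rewrite sum_nat_const_nat; lia.
  + by move=> i s2 _ [/Iin[]].
  + move=> q s2 qn eq [Iq ep2]; apply: wp_frame.
    apply: wp_weaken (Ibody p q s2 pm qn ep2 eq Iq) (leqnn _) _ => s3 I3 fz _.
    split; last by mem_simpl; rewrite fz.
    by apply: Ivar => //; apply: Iext I3 => x y; rewrite visitedS.
  + by split; [exact: Ivar|mem_simpl].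
  + by move=> s2 [I2 _]; apply: Ivar => //; apply: Iext I2 => x y; rewrite visited_row.
- apply: Ivar => //; apply: Iext I0 => x y; rewrite /visited /in_box /=; lia.
- by move=> s' Im; apply: IQ; apply: Iext Im => x y; rewrite /visited /in_box /=; lia.
Qed.

Definition sol_state k s := [/\ setup s, sums_at 0 s & zmem s vk 0 0 = k%:Z].

Lemma next_value_correct k p q s (P : int -> int -> bool) :
  (k < e)%N -> (p < m)%N -> (q < n)%N ->
  zmem s vp 0 0 = p%:Z -> zmem s vq 0 0 = q%:Z -> sol_state k s ->
  (forall x y, rmem s 1 x y = sol k x y) ->
  (forall x y, P x y -> rmem s 2 x y = sol k.+1 x y) ->
  wp s next_value 300 (fun s' => [/\ sol_state k s',
    (forall x y, rmem s' 1 x y = sol k x y) &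
    (forall x y, P x y || ((x == p%:Z) && (y == q%:Z)) ->
       rmem s' 2 x y = sol k.+1 x y)]).
Proof.
move=> ke pm qn ep eq [st sf ek] G H; have [[_ _ _ iD] _ _] := st.
have [d1 d2] := iD _ (leq_trans ke e_le).
pose a := sol k (p%:Z - (w k).1) (q%:Z - (w k).2) - sol k p%:Z q%:Z.
have subE s' (x y : rexp) : reval s' (RSub x y) = reval s' x - reval s' y by [].
have addE s' (x y : rexp) : reval s' (RAdd x y) = reval s' x + reval s' y by [].
have getE s' x z c : reval s' (RGet x z c) = rmem s' x (zeval s' z) (zeval s' c) by [].
apply: (@wp_seq _ 50 250) => //.
apply: (@wp_rset _ p%:Z q%:Z a) => //.
  by rewrite subE !getE /= ep eq ek d1 d2 !G.
set s1 := rput _ _ _ _ _.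
have erep : beval s1 e_is_rep = is_rep (w k) (box_at k.+1) p%:Z q%:Z.
  exact: (beval_is_rep e_le (s := s1) st ke ek ep eq).
(* Row [k] has kept the sums of [quot_at k.+1], the values of [part_at k] at first points. *)
have solE : sol k.+1 p%:Z q%:Z
    = (if is_rep (w k) (box_at k.+1) p%:Z q%:Z
       then rmem s 0 k%:Z (crd (w k) p%:Z q%:Z) else 0) + a.
  by rewrite /= /part_at /rep_part sf // maxn0 /a addrA.
apply: (@wp_if _ 60) => // [rep|nrep].
  apply: (@wp_rset _ p%:Z q%:Z (sol k.+1 p%:Z q%:Z)) => //.
    rewrite addE !getE (zeval_crd e_le (s := s1) (eh := zvar vk) st ke ek ep eq).
    rewrite solE -erep rep addrC.
    by rewrite /= zmem_rput ep eq ek /s1; mem_simpl.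
  split; first by [].
    by move=> x y; rewrite /s1; mem_simpl.
  move=> x y; rewrite /s1 !rputE; case: (boolP (_ && _)) => [/andP[/eqP-> /eqP->] //|].
  by rewrite orbF => _; exact: H.
apply: wp_skip; split; first by [].
  by move=> x y; rewrite /s1; mem_simpl.
move=> x y; rewrite /s1 rputE; case: (boolP (_ && _)) => [/andP[/eqP-> /eqP->] _|].
  by rewrite solE -erep (negbTE nrep) add0r.
by rewrite orbF => _; exact: H.
Qed.

Lemma sol_atS_out k x y : (k < e)%N -> ~~ in_box A x y ->
  sol k.+1 x y = 0 /\ sol k x y = 0.
Proof.
move=> ke nA; have out k' : (k' <= e)%N -> sol k' x y = 0.
  move=> k'e; apply: supported_sol_at => //.
  by apply: contra nA; exact: sub_box_at.
by split; apply: out => //; exact: ltnW.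
Qed.

Lemma backward_body_correct k s : (k < e)%N -> sol_state k s ->
  (forall x y, rmem s 1 x y = sol k x y) ->
  wp s (grid_loop next_value ;; grid_loop copy_value) (800 * (m * n))
    (fun s' => sol_state k s' /\ forall x y, rmem s' 1 x y = sol k.+1 x y).
Proof.
move=> ke st G.
have m_mn := leq_pmulr m n_gt0.
have mn_gt0 : (0 < m * n)%N by rewrite muln_gt0 m_gt0.
apply: (@wp_seq _ (500 * (m * n)) (300 * (m * n))); first by lia.
apply: (@wp_grid_loop (fun P s' => [/\ sol_state k s',
    (forall x y, rmem s' 1 x y = sol k x y) &
    (forall x y, P x y -> rmem s' 2 x y = sol k.+1 x y)]) _ 300) => //.
- by lia.
- by move=> P P' s' eP [? ? H]; split=> // x y Pxy; apply: H; rewrite eP.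
- by move=> P s' [[[]]].
- by move=> x P s' a; rewrite !inE => /orP[]/eqP-> [].
- move=> p q s' pm qn ep eq [st' G' H'].
  exact: next_value_correct.
move=> s1 [st1 G1 H1].
(* During the copy, array 1 mixes both stages; this is harmless since only array 2 is read. *)
apply: (@wp_grid_loop (fun P s' => [/\ sol_state k s',
    (forall x y, rmem s' 1 x y = if P x y then sol k.+1 x y else sol k x y) &
    (forall x y, in_box A x y -> rmem s' 2 x y = sol k.+1 x y)]) _ 40) => //.
- by lia.
- by move=> P P' s' eP [? H ?]; split=> // x y; rewrite H eP.
- by move=> P s' [[[]]].
- by move=> x P s' a; rewrite !inE => /orP[]/eqP-> [].
- move=> p q s' pm qn ep eq [st' G' H'].
  have pqA : in_box A p%:Z q%:Z by rewrite /in_box /=; lia.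
  apply: (@wp_rset _ p%:Z q%:Z (sol k.+1 p%:Z q%:Z)) => //.
    by rewrite /= ep eq H'.
  split=> // x y.
  rewrite rputE G' orbC; case: (boolP (_ && _)) => [/andP[/eqP-> /eqP->] //|_].
  by [].
- move=> s2 [st2 G2 _]; split=> // x y; rewrite G2; case: ifP => // /negbT nA.
  by have [-> ->] := sol_atS_out ke nA.
Qed.

Lemma backward_correct s : setup s -> sums_at 0 s ->
  (forall x y, rmem s 1 x y = 0) ->
  wp s backward (900 * (size D * m * n) + 40)
    (fun s' => forall x y, rmem s' 1 x y = sol e x y).
Proof.
move=> st sf G.
have mn_gt0 : (0 < m * n)%N by rewrite muln_gt0 m_gt0.
apply: (@wp_for _ (fun k s' => [/\ setup s', sums_at 0 s' &
   forall x y, rmem s' 1 x y = sol k x y]) (fun _ => 800 * (m * n))%N e) => //.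
- rewrite sum_nat_const_nat; have := leq_mul e_le (leqnn (m * n)%N).
  by have := leq_mul e_le mn_gt0; lia.
- by move=> i s' _ [[_ [we _] _] _].
- move=> k s' ke ek [st' sf' G'].
  by apply: wp_weaken (backward_body_correct ke _ G') _ _ => // s2 [[? ? _] ?].
- by move=> s' [].
Qed.

End Backward.

(** * Extension by zero and the final assembly *)

Section Extension.
Variables (R : realType) (m n : nat) (f : grid m n -> R).

Definition extend (x y : int) : R :=
  \sum_(u : grid m n | ((u.1 : nat)%:Z == x) && ((u.2 : nat)%:Z == y)) f u.

Lemma extendE (u : grid m n) : extend (u.1 : nat)%:Z (u.2 : nat)%:Z = f u.
Proof. by rewrite /extend (big_pred1 u). Qed.

Lemma supported_extend : supported extend (grid_box m n).
Proof.
move=> x y nA; rewrite /extend big1 // => [[p q]] /andP[/eqP ex /eqP ey].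
case/negP: nA; rewrite -ex -ey /in_box /=.
by have := ltn_ord p; have := ltn_ord q; lia.
Qed.

End Extension.

Lemma line_sumE (R : realType) (m n : nat) (g : grid m n -> R) F v c :
  (forall u : grid m n, F (u.1 : nat)%:Z (u.2 : nat)%:Z = g u) ->
  line_sum g v c = lsum m n F v c.
Proof.
move=> Fg; rewrite /line_sum /lsum /gsum big_mkcond; apply: eq_bigr => u _.
by rewrite Fg /crd subr_eq addrC.
Qed.

(** For a direction of index below [e] this is [lsum_err_at]. Otherwise [e < size D], so by the
    stopping rule the last box is empty and the error vanishes. *)
Lemma lsum_sol_at (R : realType) m n D e (f : int -> int -> R) v c :
  direction_set D -> (e <= size D)%N -> scan_spec m n D (size D) e ->
  supported f (grid_box m n) -> v \in D ->
  lsum m n f v c = lsum m n (sol_at m n e (nth 0 D) f e) v c.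
Proof.
move=> dD eD [_ _ e_end] sf vD; apply/eqP; rewrite -subr_eq0 -lsumB; apply/eqP.
pose h := index v D; have hD : (h < size D)%N by rewrite index_mem.
have wh : nth 0 D h = v by exact: nth_index.
have prim k : (k < e)%N -> primitive (nth 0 D k) by exact: w_prim.
have -> : lsum m n (fun x y => f x y - sol_at m n e (nth 0 D) f e x y) v c
   = lsum m n (err_at m n e (nth 0 D) f e) (nth 0 D h) c.
  by rewrite wh; apply: eq_lsum => x y _; rewrite /err_at quot_at_top.
have [he|eh] := ltnP h e; first exact: lsum_err_at.
have [B1 B2] := box_at_width m n e (nth 0 D).
rewrite (eq_lsum (G := fun _ _ => 0)); first by rewrite /lsum gsum0 // => x y _; case: ifP.
move=> x y _; apply: err_at_empty => // {}x {}y; rewrite /in_box.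
case: e_end => [e_d|e_end]; first by rewrite -e_d ltnNge eh in hD.
move: B1 B2; rewrite -/(sum1 D e) -/(sum2 D e).
case: box_at => [[x0 x1] [y0 y1]] /=; lia.
Qed.

Theorem theorem7 (R : realType) :
  exists (P : cmd) (C : nat),
  forall (m n : nat) (D : seq (int * int)),
    (0 < m)%N -> (0 < n)%N -> (0 < size D)%N -> direction_set D ->
  forall f : grid m n -> R,
  exists (t : nat) (s : state R),
    let g : grid m n -> R := output s in
    [/\ exec P (input_state m n D (line_sum f)) t s,
        (t <= C * (size D * m * n))%N,
        (forall (v : int * int) (c : int),
           v \in D -> line_sum g v c = line_sum f v c) &
        (forall u : grid m n,
           (forall S : {set grid m n}, switching_domain R D S -> u \notin S) ->
           g u = f u)].
Proof.
(* The constant leaves room for the four phases; their lower terms are absorbed because [size D],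
   [m] and [n] are positive. *)
exists reconstruct, 5000%N => m n D m0 n0 d0 dD f.
pose F := extend f; have sF : supported F (grid_box m n) by exact: supported_extend.
suff : wp (input_state m n D (line_sum f)) reconstruct
    (5000 * (size D * m * n))
    (fun s => forall v c, v \in D -> line_sum (output s : grid m n -> R) v c = line_sum f v c).
  case=> t [s [ex le_t gE]]; exists t, s; split=> // u noS.
  (* Equal line sums make [f - g] a switching function; its support is a switching domain, which
     therefore misses [u]. *)
  pose G u := f u - output s u.
  have : u \notin [set u | G u != 0].
    apply: noS; exists G => // v c vD.
    by rewrite /line_sum sumrB -!/(line_sum _ _ _) gE // subrr.
  by rewrite inE negbK subr_eq0 => /eqP.
have dmn : (size D <= size D * m * n)%N.
  by rewrite -mulnA leq_pmulr // muln_gt0 m0.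
have ins : inputs m n D (input_state m n D (line_sum f)).
  by split=> // h hD; rewrite /= /zmem /= hD.
apply: (@wp_seq _ (240 * size D + 100) (4000 * (size D * m * n))); first by lia.
apply: wp_frame; apply: wp_weaken (scan_correct ins) (leqnn _) _.
move=> s1 [ins1 [e [espec sc1]]] _ r1; have [eD _ _] := espec.
apply: (@wp_seq _ (340 * e + 200) (3200 * (size D * m * n))); first by lia.
apply: wp_frame; apply: wp_weaken (boxes_correct eD ins1 sc1) (leqnn _) _.
move=> s2 st2 _ r2.
apply: (@wp_seq _ (2000 * (size D * m * n) + 100) (900 * (size D * m * n) + 40)); first by lia.
(* The first two phases write no real cells, and [maxn h.+1 e = e], so array 0 holds the sums of
   [F = quot_at e]. *)
have sf2 : sums_at m n D e F e s2.
  move=> h c he; rewrite r2 // r1 // (maxn_idPr he) quot_at_top.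
  rewrite /rmem /= (leq_trans he eD); apply: line_sumE => u; exact: extendE.
apply: wp_frame; apply: wp_weaken (forward_correct eD dD sF m0 n0 espec st2 sf2) (leqnn _) _.
move=> s3 [st3 sf3] _ r3.
(* Array 1 is still unwritten and thus holds the zero function [sol_at 0]. *)
have G3 x y : rmem s3 1 x y = 0 by rewrite r3 // r2 // r1.
 apply: wp_weaken (backward_correct eD dD m0 n0 st3 sf3 G3) (leqnn _) _.
move=> s4 s4E v c vD; rewrite (line_sumE (F := sol_at m n e (nth 0 D) F e)).
  rewrite -lsum_sol_at // (line_sumE (F := F)) // => u; exact: extendE.
by move=> u; rewrite -s4E.
Qed.
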